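(* Let $\Gamma \vdash P$ and $P \xrightarrow{\ell} Q$. Then $\Gamma' \vdash Q$ for some type environment $\Gamma'$ such that $\Gamma \xrightarrow{\ell} \Gamma'$.
   Context: **Language.** Fix a countable set of channels $a,b,c,\dots$ and a disjoint countable set of variables $x,y,\dots$; names $u$ are channels or variables. Expressions: $e,f ::= n$ (integer constants) $\mid u \mid (e,f) \mid \mathsf{fst}(e) \mid \mathsf{snd}(e) \mid \mathsf{inl}(e) \mid \mathsf{inr}(e)$. Values $v,w$ are expressions with no variables and no occurrences of $\mathsf{fst},\mathsf{snd}$. Processes: $P,Q ::= \mathsf{idle} \mid e?(x).P \mid e!f \mid P\,|\,Q \mid {*}P \mid \mathsf{new}\ a\ \mathsf{in}\ P \mid \mathsf{case}\ e\ \{i(x_i)\Rightarrow P_i\}_{i=\mathsf{inl},\mathsf{inr}}$. Input binds $x$ in $P$, $\mathsf{new}$ binds $a$ in $P$, $\mathsf{case}$ binds $x_i$ in $P_i$; $\mathsf{fn}(P)$ is the set of free names; processes are identified modulo renaming of bound names; $P\{v/x\}$ is capture-avoiding substitution. **Structural pre-congruence** $\preccurlyeq$ is the least pre-congruence (reflexive, transitive, preserved by the process constructs) containing, where $\equiv$ means both directions of $\preccurlyeq$: $\mathsf{idle}\,|\,P\equiv P$; $P\,|\,Q\equiv Q\,|\,P$; $P\,|\,(Q\,|\,R)\equiv (P\,|\,Q)\,|\,R$; ${*}P\preccurlyeq {*}P\,|\,P$ (one direction only); $\mathsf{new}\ a\ \mathsf{in}\ \mathsf{new}\ b\ \mathsf{in}\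 P\equiv \mathsf{new}\ b\ \mathsf{in}\ \mathsf{new}\ a\ \mathsf{in}\ P$; $(\mathsf{new}\ a\ \mathsf{in}\ P)\,|\,Q\equiv \mathsf{new}\ a\ \mathsf{in}\ (P\,|\,Q)$ if $a\notin\mathsf{fn}(Q)$. **Evaluation** $e\downarrow v$: $n\downarrow n$; $a\downarrow a$; if $e_i\downarrow v_i$ ($i=1,2$) then $(e_1,e_2)\downarrow(v_1,v_2)$; if $e\downarrow(v,w)$ then $\mathsf{fst}(e)\downarrow v$ and $\mathsf{snd}(e)\downarrow w$; if $e\downarrow v$ then $k(e)\downarrow k(v)$ for $k\in\{\mathsf{inl},\mathsf{inr}\}$. **Reduction** $P\xrightarrow{\ell}Q$, where the label $\ell$ is a channel or $\tau$: (comm) if $e_1\downarrow a$, $e_2\downarrow a$, $f\downarrow v$ then $e_1!f\,|\,e_2?(x).Q\xrightarrow{a}Q\{v/x\}$; (case) if $e\downarrow k(v)$ with $k\in\{\mathsf{inl},\mathsf{inr}\}$ then $\mathsf{case}\ e\ \{i(x_i)\Rightarrow P_i\}_{i=\mathsf{inl},\mathsf{inr}}\xrightarrow{\tau}P_k\{v/x_k\}$; (par) if $P\xrightarrow{\ell}P'$ then $P\,|\,Q\xrightarrow{\ell}P'\,|\,Q$; (new 1) if $P\xrightarrow{a}Q$ then $\mathsf{new}\ a\ \mathsf{in}\ P\xrightarrow{\tau}\mathsf{new}\ a\ \mathsf{in}\ Q$; (new 2) if $P\xrightarrow{\ell}Q$ and $\ell\neq a$ then $\mathsf{new}\ a\ \mathsf{in}\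 P\xrightarrow{\ell}\mathsf{new}\ a\ \mathsf{in}\ Q$; (struct) if $P\preccurlyeq P'$, $P'\xrightarrow{\ell}Q'$, $Q'\preccurlyeq Q$ then $P\xrightarrow{\ell}Q$. **Types.** Uses $\kappa\in\{0,1,\omega\}$, with $\kappa+0=0+\kappa=\kappa$ and $\kappa_1+\kappa_2=\omega$ if both are nonzero; $2\kappa:=\kappa+\kappa$. Types $t,s$ are the possibly infinite regular trees built from the nullary constructor $\mathsf{int}$, unary constructors $[\cdot]^{\kappa_1,\kappa_2}$ (channel types; $\kappa_1$ input use, $\kappa_2$ output use), binary $\times$ and $\oplus$; type equality is equality of trees; $\odot$ stands for $\times$ or $\oplus$. Type combination $+$ is the partial binary function on types whose graph is the largest relation $\mathcal R$ such that $((t_1,t_2),s)\in\mathcal R$ implies: either $t_1=t_2=s=\mathsf{int}$; or $t_1=[t]^{\kappa_1,\kappa_2}$, $t_2=[t]^{\kappa_3,\kappa_4}$, $s=[t]^{\kappa_1+\kappa_3,\kappa_2+\kappa_4}$; or $t_1=t_{11}\odot t_{12}$, $t_2=t_{21}\odot t_{22}$, $s=s_1\odot s_2$ with $((t_{1i},t_{2i}),s_i)\in\mathcal R$ for $i=1,2$ (same $\odot$ throughout). A type $t$ is unlimited, $\mathsf{un}(t)$, if $t+t=t$. **Environments.** A type environment $\Gamma$ is a finite map from names to types; $\Gamma_1,\Gamma_2$ is union of environments with disjoint domains. $\Gamma_1+\Gamma_2$ is the environment with domain $\mathrm{dom}(\Gamma_1)\cup\mathrm{dom}(\Gamma_2)$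 mapping $u$ to $\Gamma_1(u)+\Gamma_2(u)$ if $u$ is in both domains (undefined if some such combination is undefined) and to $\Gamma_i(u)$ if $u$ is only in $\mathrm{dom}(\Gamma_i)$. $\mathsf{un}(\Gamma)$ means all types in the range of $\Gamma$ are unlimited. **Typing of expressions** $\Gamma\vdash e:t$: $\Gamma\vdash n:\mathsf{int}$ if $\mathsf{un}(\Gamma)$; $\Gamma,u:t\vdash u:t$ if $\mathsf{un}(\Gamma)$; if $\Gamma\vdash e:t$ then $\Gamma\vdash\mathsf{inl}(e):t\oplus s$; if $\Gamma\vdash e:s$ then $\Gamma\vdash\mathsf{inr}(e):t\oplus s$; if $\Gamma_i\vdash e_i:t_i$ ($i=1,2$) then $\Gamma_1+\Gamma_2\vdash(e_1,e_2):t_1\times t_2$; if $\Gamma\vdash e:t\times s$ and $\mathsf{un}(s)$ then $\Gamma\vdash\mathsf{fst}(e):t$; if $\Gamma\vdash e:t\times s$ and $\mathsf{un}(t)$ then $\Gamma\vdash\mathsf{snd}(e):s$. **Typing of processes** $\Gamma\vdash P$ (combinations in conclusions are required to be defined): $\Gamma\vdash\mathsf{idle}$ if $\mathsf{un}(\Gamma)$; if $\Gamma_1\vdash e:[t]^{1+\kappa_1,2\kappa_2}$ and $\Gamma_2,x:t\vdash P$ then $\Gamma_1+\Gamma_2\vdash e?(x).P$; if $\Gamma_1\vdash e:[t]^{2\kappa_1,1+\kappa_2}$ and $\Gamma_2\vdash f:t$ then $\Gamma_1+\Gamma_2\vdash e!f$; if $\Gamma\vdash P$ and $\mathsf{un}(\Gamma)$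 then $\Gamma\vdash{*}P$; if $\Gamma_i\vdash P_i$ ($i=1,2$) then $\Gamma_1+\Gamma_2\vdash P_1\,|\,P_2$; if $\Gamma,a:[t]^{\kappa,\kappa}\vdash P$ then $\Gamma\vdash\mathsf{new}\ a\ \mathsf{in}\ P$; if $\Gamma_1\vdash e:t_{\mathsf{inl}}\oplus t_{\mathsf{inr}}$ and $\Gamma_2,x_i:t_i\vdash P_i$ for $i=\mathsf{inl},\mathsf{inr}$ then $\Gamma_1+\Gamma_2\vdash\mathsf{case}\ e\ \{i(x_i)\Rightarrow P_i\}_{i=\mathsf{inl},\mathsf{inr}}$. **Reduction of environments.** $\xrightarrow{\ell}$ is the least relation between type environments such that $\Gamma\xrightarrow{\tau}\Gamma$ for every $\Gamma$, and $\Gamma+(a:[t]^{1,1})\xrightarrow{a}\Gamma$ whenever the combination is defined. *)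

(* Defs.v *)
From HB Require Import structures.
From Stdlib Require Import FunctionalExtensionality ProofIrrelevance.
From mathcomp Require Import all_boot all_order all_algebra finmap.

Set Implicit Arguments.
Unset Strict Implicit.
Unset Printing Implicit Defensive.

Local Open Scope fset_scope.
Local Open Scope fmap_scope.

Definition channel := nat.
Definition variable := nat.

Inductive name := Chan of channel | Var of variable.

Definition sum_of_name (u : name) : nat + nat :=
  match u with Chan a => inl a | Var x => inr x end.
Definition name_of_sum (s : nat + nat) : name :=
  match s with inl a => Chan a | inr x => Var x end.
Lemma sum_of_nameK : cancel sum_of_name name_of_sum.
Proof. by case. Qed.

HB.instance Definition _ := Countable.copy name (can_type sum_of_nameK).

(* Processes are identified modulo renaming of bound names by means of a      *)
(* well-scoped locally nameless syntax: free names are of type name, and a    *)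
(* bound occurrence is a de Bruijn index, which is less than the number n of  *)
(* enclosing binders. The expressions and processes of the calculus are those *)
(* with n = 0. Only the derived operations PIn, PNew and PCase below, which   *)
(* abstract a name, are used to state the rules; two representatives of the   *)
(* same process, such as PNew a P and PNew b P' with P' obtained by renaming, *)
(* are equal terms.                                                           *)

Inductive expr (n : nat) :=
| EInt of int
| EName of name
| EBound of 'I_n
| EPair of expr n & expr n
| EFst of expr n
| ESnd of expr n
| EInl of expr n
| EInr of expr n.

Arguments EInt {n}.
Arguments EName {n}.

Inductive proc (n : nat) :=
| PIdle
| PInB of expr n & proc n.+1
| POut of expr n & expr n
| PPar of proc n & proc n
| PRep of proc n
| PNewB of proc n.+1
| PCaseB of expr n & proc n.+1 & proc n.+1.

Arguments PIdle {n}.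

Notation expression := (expr 0).
Notation process := (proc 0).

(* Replace the free name u with the index of a new outermost binder. *)
Fixpoint eclose n (u : name) (e : expr n) : expr n.+1 :=
  match e with
  | EInt k => EInt k
  | EName w => if w == u then EBound ord_max else EName w
  | EBound i => EBound (widen_ord (leqnSn n) i)
  | EPair e1 e2 => EPair (eclose u e1) (eclose u e2)
  | EFst e1 => EFst (eclose u e1)
  | ESnd e1 => ESnd (eclose u e1)
  | EInl e1 => EInl (eclose u e1)
  | EInr e1 => EInr (eclose u e1)
  end.

Fixpoint pclose n (u : name) (P : proc n) : proc n.+1 :=
  match P with
  | PIdle => PIdle
  | PInB e Q => PInB (eclose u e) (pclose u Q)
  | POut e f => POut (eclose u e) (eclose u f)
  | PPar Q1 Q2 => PPar (pclose u Q1) (pclose u Q2)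
  | PRep Q => PRep (pclose u Q)
  | PNewB Q => PNewB (pclose u Q)
  | PCaseB e Q1 Q2 => PCaseB (eclose u e) (pclose u Q1) (pclose u Q2)
  end.

(* e?(x).P *)
Definition PIn (e : expression) (x : variable) (P : process) : process :=
  PInB e (pclose (Var x) P).

(* new a in P *)
Definition PNew (a : channel) (P : process) : process :=
  PNewB (pclose (Chan a) P).

(* case e {inl(x) => P, inr(y) => Q} *)
Definition PCase (e : expression) (x : variable) (P : process)
    (y : variable) (Q : process) : process :=
  PCaseB e (pclose (Var x) P) (pclose (Var y) Q).

Fixpoint efn n (e : expr n) : {fset name} :=
  match e with
  | EInt _ | EBound _ => fset0
  | EName u => [fset u]
  | EPair e1 e2 => efn e1 `|` efn e2
  | EFst e1 | ESnd e1 | EInl e1 | EInr e1 => efn e1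
  end.

Fixpoint fn n (P : proc n) : {fset name} :=
  match P with
  | PIdle => fset0
  | PInB e Q => efn e `|` fn Q
  | POut e f => efn e `|` efn f
  | PPar Q1 Q2 => fn Q1 `|` fn Q2
  | PRep Q => fn Q
  | PNewB Q => fn Q
  | PCaseB e Q1 Q2 => efn e `|` (fn Q1 `|` fn Q2)
  end.

Fixpoint eweaken n (v : expression) : expr n :=
  match v with
  | EInt k => EInt k
  | EName w => EName w
  | EBound i => EBound (widen_ord (leq0n n) i)
  | EPair e1 e2 => EPair (eweaken n e1) (eweaken n e2)
  | EFst e1 => EFst (eweaken n e1)
  | ESnd e1 => ESnd (eweaken n e1)
  | EInl e1 => EInl (eweaken n e1)
  | EInr e1 => EInr (eweaken n e1)
  end.

(* No capture is possible: the names of v are free, those bound in e are indices. *)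
Fixpoint esubst n (x : variable) (v : expression) (e : expr n) : expr n :=
  match e with
  | EInt k => EInt k
  | EName w => if w == Var x then eweaken n v else EName w
  | EBound i => EBound i
  | EPair e1 e2 => EPair (esubst x v e1) (esubst x v e2)
  | EFst e1 => EFst (esubst x v e1)
  | ESnd e1 => ESnd (esubst x v e1)
  | EInl e1 => EInl (esubst x v e1)
  | EInr e1 => EInr (esubst x v e1)
  end.

Fixpoint psubst n (x : variable) (v : expression) (P : proc n) : proc n :=
  match P with
  | PIdle => PIdle
  | PInB e Q => PInB (esubst x v e) (psubst x v Q)
  | POut e f => POut (esubst x v e) (esubst x v f)
  | PPar Q1 Q2 => PPar (psubst x v Q1) (psubst x v Q2)
  | PRep Q => PRep (psubst x v Q)
  | PNewB Q => PNewB (psubst x v Q)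
  | PCaseB e Q1 Q2 => PCaseB (esubst x v e) (psubst x v Q1) (psubst x v Q2)
  end.

Inductive struct_ax : process -> process -> Prop :=
| SAIdle P : struct_ax (PPar PIdle P) P
| SAParC P Q : struct_ax (PPar P Q) (PPar Q P)
| SAParA P Q R : struct_ax (PPar P (PPar Q R)) (PPar (PPar P Q) R)
| SANewC a b P : struct_ax (PNew a (PNew b P)) (PNew b (PNew a P))
| SANewPar a P Q : Chan a \notin fn Q ->
    struct_ax (PPar (PNew a P) Q) (PNew a (PPar P Q)).

Inductive precong : process -> process -> Prop :=
| PCAx P Q : struct_ax P Q -> precong P Q
| PCAxSym P Q : struct_ax P Q -> precong Q P
| PCRepAx P : precong (PRep P) (PPar (PRep P) P)
| PCRefl P : precong P P
| PCTrans P Q R : precong P Q -> precong Q R -> precong P R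
| PCIn e x P P' : precong P P' -> precong (PIn e x P) (PIn e x P')
| PCPar P P' Q Q' : precong P P' -> precong Q Q' ->
    precong (PPar P Q) (PPar P' Q')
| PCRep P P' : precong P P' -> precong (PRep P) (PRep P')
| PCNew a P P' : precong P P' -> precong (PNew a P) (PNew a P')
| PCCase e x P P' y Q Q' : precong P P' -> precong Q Q' ->
    precong (PCase e x P y Q) (PCase e x P' y Q').

Fixpoint value (e : expression) : bool :=
  match e with
  | EInt _ | EName (Chan _) => true
  | EPair e1 e2 => value e1 && value e2
  | EInl e1 | EInr e1 => value e1
  | _ => false
  end.

Inductive eval : expression -> expression -> Prop :=
| EvInt k : eval (EInt k) (EInt k)
| EvChan a : eval (EName (Chan a)) (EName (Chan a))
| EvPair e1 e2 v1 v2 : eval e1 v1 -> eval e2 v2 ->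
    eval (EPair e1 e2) (EPair v1 v2)
| EvFst e v w : eval e (EPair v w) -> eval (EFst e) v
| EvSnd e v w : eval e (EPair v w) -> eval (ESnd e) w
| EvInl e v : eval e v -> eval (EInl e) (EInl v)
| EvInr e v : eval e v -> eval (EInr e) (EInr v).

(* Hence the results v, w of evaluation in the rules below are values. *)
Lemma eval_value e v : eval e v -> value v.
Proof.
elim=> //= [e1 e2 v1 v2 _ -> _ -> // | {}e v1 w _ /andP[] // |].
by move=> {}e v1 w _ /andP[].
Qed.

Inductive label := LChan of channel | LTau.

Inductive red : label -> process -> process -> Prop :=
| RComm e1 e2 f a v x Q :
    eval e1 (EName (Chan a)) -> eval e2 (EName (Chan a)) -> eval f v ->
    red (LChan a) (PPar (POut e1 f) (PIn e2 x Q)) (psubst x v Q)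
| RCaseInl e v x P y Q : eval e (EInl v) ->
    red LTau (PCase e x P y Q) (psubst x v P)
| RCaseInr e v x P y Q : eval e (EInr v) ->
    red LTau (PCase e x P y Q) (psubst y v Q)
| RPar l P P' Q : red l P P' -> red l (PPar P Q) (PPar P' Q)
| RNew1 a P Q : red (LChan a) P Q -> red LTau (PNew a P) (PNew a Q)
| RNew2 l a P Q : red l P Q -> l <> LChan a -> red l (PNew a P) (PNew a Q)
| RStruct l P P' Q Q' : precong P P' -> red l P' Q' -> precong Q' Q ->
    red l P Q.

Inductive use := U0 | U1 | Uomega.

Definition uadd (k1 k2 : use) : use :=
  match k1, k2 with
  | U0, k => k
  | k, U0 => k
  | _, _ => Uomega
  end.

Inductive binop := Times | Plus.

Inductive constructor :=
| CInt
| CChan of use & use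
| CBin of binop.

Definition arity (c : constructor) : nat :=
  match c with CInt => 0 | CChan _ _ => 1 | CBin _ => 2 end.

(* A possibly infinite tree is a partial map from positions to constructors;  *)
(* a position is the sequence of child numbers leading to it from the root.   *)
Definition labelling := seq nat -> option constructor.

Definition is_tree (t : labelling) : Prop :=
  isSome (t [::]) /\
  forall p i, isSome (t (rcons p i)) =
    (if t p is Some c then i < arity c else false).

Definition subtree (t : labelling) (p : seq nat) : labelling :=
  fun q => t (p ++ q).

(* Regularity: finitely many distinct subtrees, ps being a finite set of      *)
(* positions at which all of them occur.                                      *)
Definition is_regular (t : labelling) : Prop :=
  exists ps : seq (seq nat), forall p, isSome (t p) ->
    exists2 p', p' \in ps & subtree t p =1 subtree t p'.

Record ty := Ty {
  lab : labelling;
  lab_tree : is_tree lab;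
  lab_regular : is_regular lab
}.

Lemma ty_ext (t s : ty) : lab t =1 lab s -> t = s.
Proof.
case: t s => [t tT tR] [s sT sR] /= /functional_extensionality ts.
by case: _ / ts in sT sR *; congr Ty; exact: proof_irrelevance.
Qed.

Definition int_lab : labelling :=
  fun p => if p is [::] then Some CInt else None.

Definition chan_lab (k1 k2 : use) (t : labelling) : labelling :=
  fun p => match p with
  | [::] => Some (CChan k1 k2)
  | 0 :: q => t q
  | _ => None
  end.

Definition bin_lab (o : binop) (t s : labelling) : labelling :=
  fun p => match p with
  | [::] => Some (CBin o)
  | 0 :: q => t q
  | 1 :: q => s q
  | _ => None
  end.

Lemma int_tree : is_tree int_lab.
Proof. by split=> //; case=> [|j p] i. Qed.

Lemma int_regular : is_regular int_lab.
Proof. by exists [:: [::]]; case=> // _; exists [::]. Qed.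

Lemma chan_tree k1 k2 t : is_tree t -> is_tree (chan_lab k1 k2 t).
Proof.
by case=> t0 tT; split=> //; case=> [|[|j] p] i //=; case: i.
Qed.

Lemma chan_regular k1 k2 t : is_regular t -> is_regular (chan_lab k1 k2 t).
Proof.
case=> ps psP; exists ([::] :: map (cons 0) ps).
case=> [|[|j] p] //= tp; first by exists [::].
have [p' p'ps eqp] := psP p tp; exists (0 :: p'); last exact: eqp.
by rewrite inE map_f ?orbT.
Qed.

Lemma bin_tree o t s : is_tree t -> is_tree s -> is_tree (bin_lab o t s).
Proof.
case=> t0 tT [s0 sT]; split=> //.
by case=> [|[|[|j]] p] i //=; case: i => [|[|i]].
Qed.

Lemma bin_regular o t s :
  is_regular t -> is_regular s -> is_regular (bin_lab o t s).
Proof.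
case=> ps psP [qs qsP].
exists ([::] :: map (cons 0) ps ++ map (cons 1) qs).
case=> [|[|[|j]] p] //= tp; first by exists [::].
- have [p' p'ps eqp] := psP p tp; exists (0 :: p'); last exact: eqp.
  by rewrite inE mem_cat map_f ?orbT.
- have [p' p'ps eqp] := qsP p tp; exists (1 :: p'); last exact: eqp.
  by rewrite inE mem_cat [X in _ || (_ || X)]map_f ?orbT.
Qed.

Definition TInt : ty := Ty int_tree int_regular.
(* [t]^{k1,k2}: k1 is the input use, k2 the output use *)
Definition TChan (k1 k2 : use) (t : ty) : ty :=
  Ty (chan_tree k1 k2 (lab_tree t)) (chan_regular k1 k2 (lab_regular t)).
Definition TBin (o : binop) (t s : ty) : ty :=
  Ty (bin_tree o (lab_tree t) (lab_tree s))
     (bin_regular o (lab_regular t) (lab_regular s)).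

(* The graph of the partial operation +: tadd t1 t2 s means t1 + t2 = s. *)
CoInductive tadd : ty -> ty -> ty -> Prop :=
| TAInt : tadd TInt TInt TInt
| TAChan t k1 k2 k3 k4 :
    tadd (TChan k1 k2 t) (TChan k3 k4 t) (TChan (uadd k1 k3) (uadd k2 k4) t)
| TABin o t11 t12 t21 t22 s1 s2 :
    tadd t11 t21 s1 -> tadd t12 t22 s2 ->
    tadd (TBin o t11 t12) (TBin o t21 t22) (TBin o s1 s2).

Definition un (t : ty) : Prop := tadd t t t.

(* Environments; "G, u : t" is rendered as G.[u <- t] with u \notin domf G *)

Definition env := {fmap name -> ty}.

Definition env1 (u : name) (t : ty) : env := [fmap].[u <- t].

(* envadd G1 G2 G means that G1 + G2 is defined and equal to G. *)
Definition envadd (G1 G2 G : env) : Prop :=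
  forall u, match G1.[? u], G2.[? u] with
  | Some t1, Some t2 => exists2 t, tadd t1 t2 t & G.[? u] = Some t
  | Some t1, None => G.[? u] = Some t1
  | None, Some t2 => G.[? u] = Some t2
  | None, None => G.[? u] = None
  end.

Definition unenv (G : env) : Prop := forall u t, G.[? u] = Some t -> un t.

Inductive etyping : env -> expression -> ty -> Prop :=
| TEInt G k : unenv G -> etyping G (EInt k) TInt
| TEName G u t : unenv G -> u \notin domf G ->
    etyping G.[u <- t] (EName u) t
| TEInl G e t s : etyping G e t -> etyping G (EInl e) (TBin Plus t s)
| TEInr G e t s : etyping G e s -> etyping G (EInr e) (TBin Plus t s)
| TEPair G1 G2 G e1 e2 t1 t2 :
    etyping G1 e1 t1 -> etyping G2 e2 t2 -> envadd G1 G2 G ->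
    etyping G (EPair e1 e2) (TBin Times t1 t2)
| TEFst G e t s : etyping G e (TBin Times t s) -> un s -> etyping G (EFst e) t
| TESnd G e t s : etyping G e (TBin Times t s) -> un t -> etyping G (ESnd e) s.

Inductive typing : env -> process -> Prop :=
| TPIdle G : unenv G -> typing G PIdle
| TPIn G1 G2 G e x P t k1 k2 :
    etyping G1 e (TChan (uadd U1 k1) (uadd k2 k2) t) ->
    Var x \notin domf G2 -> typing G2.[Var x <- t] P ->
    envadd G1 G2 G -> typing G (PIn e x P)
| TPOut G1 G2 G e f t k1 k2 :
    etyping G1 e (TChan (uadd k1 k1) (uadd U1 k2) t) -> etyping G2 f t ->
    envadd G1 G2 G -> typing G (POut e f)
| TPRep G P : typing G P -> unenv G -> typing G (PRep P)
| TPPar G1 G2 G P1 P2 : typing G1 P1 -> typing G2 P2 ->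
    envadd G1 G2 G -> typing G (PPar P1 P2)
| TPNew G a P t k :
    Chan a \notin domf G -> typing G.[Chan a <- TChan k k t] P ->
    typing G (PNew a P)
| TPCase G1 G2 G e x P y Q t s :
    etyping G1 e (TBin Plus t s) ->
    Var x \notin domf G2 -> typing G2.[Var x <- t] P ->
    Var y \notin domf G2 -> typing G2.[Var y <- s] Q ->
    envadd G1 G2 G -> typing G (PCase e x P y Q).

Inductive envred : label -> env -> env -> Prop :=
| ERTau G : envred LTau G G
| ERChan a t G G' : envadd G' (env1 (Chan a) (TChan U1 U1 t)) G ->
    envred (LChan a) G G'.

(* Main.v *)
(* A proof of typing of a process may choose the name of each bound variable or
   channel. Typing is equivalent to a cofinite variant (ctyping), in which the
   body of a binder is typed for all but finitely many names; for that variant,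
   subject reduction rests on the following points.
   - The sum of types acts pointwise on their common skeleton, hence is a partial
     commutative monoid; constructing the missing partial sums needs that
     regularity is preserved.
   - Unlimited resources can be added to the environment of a process (weakening),
     although not to that of an expression with the type unchanged: a : [t]^{1,0}
     becomes a : [t]^{omega,0}. In an output the surplus goes to the subject,
     whose type leaves room for it.
   - Evaluation and substitution therefore preserve the type of an expression only
     after dropping some unlimited resources from the environment; weakening
     restores them at the level of processes.
   - In a communication on a, the uses 2k1 + (1 + k3) and (1 + k2) + 2k4 of a are
     of the form 1 + 2k, so that removing [t]^{1,1} leaves an unlimited type. *)
From Stdlib Require Import FunctionalExtensionality Classical.
From mathcomp Require Import all_boot finmap.
Require Import Defs.

Set Implicit Arguments.
Unset Strict Implicit.
Unset Printing Implicit Defensive.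

Local Open Scope fset_scope.
Local Open Scope fmap_scope.

(** * Uses, and a criterion for the regularity of a tree *)

Lemma uaddC : commutative uadd.
Proof. by case=> [] []. Qed.

Lemma uaddA : associative uadd.
Proof. by case=> [] [] []. Qed.

(** It suffices to name finitely many trees that cover all subtrees: classical logic then selects a
    position for each named tree that does occur. *)
Lemma regular_of_classes (K : eqType) (ks : seq K) (F : K -> labelling)
    (l : labelling) :
  (forall p, isSome (l p) -> exists2 k, k \in ks & subtree l p = F k) ->
  is_regular l.
Proof.
move=> lP; suff [ps psP] : exists ps : seq (seq nat), forall k p,
    k \in ks -> subtree l p = F k -> exists2 p', p' \in ps & subtree l p' = F k.
  exists ps => p /lP[k kks lk]; have [p' p'ps lk'] := psP k p kks lk.
  by exists p' => // q; rewrite lk lk'.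
elim: ks {lP} => [|k ks [ps psP]]; first by exists [::].
have [[p0 lk]|no] := classic (exists p, subtree l p = F k).
  exists (p0 :: ps) => k' p; rewrite inE => /orP[/eqP-> _|k's lk'].
    by exists p0; rewrite ?mem_head.
  have [p' p'ps e] := psP k' p k's lk'.
  by exists p'; rewrite // inE p'ps orbT.
exists ps => k' p; rewrite inE => /orP[/eqP-> lk|]; last exact: psP.
by case: no; exists p.
Qed.

(** * Combination of types *)

Definition isbin (c : option constructor) : bool :=
  if c is Some (CBin _) then true else false.

(* The position p is not below a channel constructor, so that + acts at p. *)
Fixpoint spine (l : labelling) (p : seq nat) : bool :=
  if p is i :: q then isbin (l [::]) && spine (subtree l [:: i]) q else true.

Definition erase (c : option constructor) : option constructor :=
  if c is Some (CChan _ _) then Some (CChan U0 U0) else c.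

Definition cplus (c1 c2 : option constructor) : option constructor :=
  match c1, c2 with
  | Some (CChan k1 k2), Some (CChan k3 k4) =>
      Some (CChan (uadd k1 k3) (uadd k2 k4))
  | _, _ => c1
  end.

(** The summability class of a type: uses are erased on the spine, whereas everything below a
    channel constructor is kept, since [+] demands equal payloads. *)
Definition skel (l : labelling) : labelling :=
  fun p => if spine l p then erase (l p) else l p.

(** A total candidate for the sum, meaningful when the skeletons agree; on mismatched constructors
    [cplus] falls back on its first argument. *)
Definition lsum (l1 l2 : labelling) : labelling :=
  fun p => if spine l1 p then cplus (l1 p) (l2 p) else l1 p.

Lemma lsumE l1 l2 p :
  lsum l1 l2 p = if spine l1 p then cplus (l1 p) (l2 p) else l1 p.
Proof. by []. Qed.

Lemma spine_cat l p q : spine l (p ++ q) = spine l p && spine (subtree l p) q.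
Proof. by elim: p l => [|i p IH] l //=; rewrite IH andbA. Qed.

Lemma erase_cplus c1 c2 : erase (cplus c1 c2) = erase c1.
Proof. by case: c1 c2 => [[|? ?|?]|] [[|? ?|?]|]. Qed.

Lemma spine_skel l p : spine (skel l) p = spine l p.
Proof.
elim: p l => [|i p IH] l //=.
have -> : isbin (skel l [::]) = isbin (l [::]).
  by rewrite /skel /=; case: (l [::]) => [[]|].
case lB: (isbin _) => //=; rewrite -[RHS]IH.
by congr spine; apply: functional_extensionality => q; rewrite /subtree /skel /= lB.
Qed.

Lemma spine_lsum l1 l2 p : spine (lsum l1 l2) p = spine l1 p.
Proof.
elim: p l1 l2 => [|i p IH] l1 l2 //=.
have -> : isbin (lsum l1 l2 [::]) = isbin (l1 [::]).
  by rewrite /lsum /=; case: (l1 [::]) (l2 [::]) => [[|? ?|?]|] [[|? ?|?]|].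
case lB: (isbin _) => //=; rewrite -[RHS](IH _ (subtree l2 [:: i])).
by congr spine; apply: functional_extensionality => q; rewrite /subtree /lsum /= lB.
Qed.

Lemma skel_spine l1 l2 p : skel l1 = skel l2 -> spine l1 p = spine l2 p.
Proof. by move=> e; rewrite -spine_skel e spine_skel. Qed.

(** [cplus] alters only uses, which [erase] forgets; this is what lets sums be iterated. *)
Lemma skel_lsum l1 l2 : skel (lsum l1 l2) = skel l1.
Proof.
apply: functional_extensionality => p; rewrite /skel spine_lsum /lsum.
by case: (spine l1 p); rewrite ?erase_cplus.
Qed.

Lemma skelP l1 l2 p : skel l1 = skel l2 ->
  if spine l1 p then erase (l1 p) = erase (l2 p) else l1 p = l2 p.
Proof.
move=> e; have := congr1 (@^~ p) e; rewrite /skel -(skel_spine p e).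
by case: ifP.
Qed.

Lemma erase_isSome c : isSome (erase c) = isSome c.
Proof. by case: c => [[]|]. Qed.

Lemma skel_dom l1 l2 p : skel l1 = skel l2 -> isSome (l1 p) = isSome (l2 p).
Proof.
move/(skelP p); case: ifP => _ e; last by rewrite e.
by rewrite -erase_isSome e erase_isSome.
Qed.

Lemma lsumC l1 l2 : skel l1 = skel l2 -> lsum l1 l2 = lsum l2 l1.
Proof.
move=> e; apply: functional_extensionality => p; have := skelP p e.
rewrite /lsum -(skel_spine p e); case: ifP => // _.
case: (l1 p) (l2 p) => [[|k1 k2|o]|] [[|k3 k4|o']|] //= _.
by rewrite !(uaddC k3, uaddC k4).
Qed.

Lemma lsumA l1 l2 l3 : skel l1 = skel l2 -> skel l2 = skel l3 ->
  lsum l1 (lsum l2 l3) = lsum (lsum l1 l2) l3.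
Proof.
move=> e12 e23; apply: functional_extensionality => p.
have := skelP p e12; have := skelP p e23.
rewrite !lsumE spine_lsum -(skel_spine p e12).
case: (spine l1 p) => //.
case: (l1 p) (l2 p) (l3 p) => [[|? ?|?]|] [[|? ?|?]|] [[|? ?|?]|] //= _ _.
by rewrite !uaddA.
Qed.

Lemma lsum_tree l1 l2 : is_tree l1 -> is_tree (lsum l1 l2).
Proof.
have lS p : isSome (lsum l1 l2 p) = isSome (l1 p).
  by rewrite /lsum; case: (spine l1 p) => //;
    case: (l1 p) (l2 p) => [[|? ?|?]|] [[|? ?|?]|].
have lA p : (if lsum l1 l2 p is Some c then Some (arity c) else None) =
            (if l1 p is Some c then Some (arity c) else None).
  by rewrite /lsum; case: (spine l1 p) => //;
    case: (l1 p) (l2 p) => [[|? ?|?]|] [[|? ?|?]|].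
case=> l0 lT; split=> [|p i]; first by rewrite lS.
rewrite lS lT; move: (lA p).
by case: (lsum _ _ p) => [c|]; case: (l1 p) => [c'|] // [->].
Qed.

(** The subtree of the sum at [p] depends only on the subtrees of the operands at [p] and on whether
    [p] lies on the spine, which leaves finitely many possibilities. *)
Lemma lsum_regular l1 l2 : skel l1 = skel l2 ->
  is_regular l1 -> is_regular l2 -> is_regular (lsum l1 l2).
Proof.
move=> e12 [ps psP] [qs qsP].
(* A key holds a representative position for each operand and a flag for the spine; off the spine
   the sum is a copy of [l1]. *)
pose F (k : seq nat * seq nat * bool) := if k.2
  then lsum (subtree l1 k.1.1) (subtree l2 k.1.2) else subtree l1 k.1.1.
apply: (@regular_of_classes _ (allpairs pair (allpairs pair ps qs) [:: true; false]) F).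
move=> p lp.
have lp1 : isSome (l1 p).
  move: lp; rewrite /lsum; case: ifP => // _.
  by case: (l1 p) (l2 p) => [[|? ?|?]|] [[|? ?|?]|].
have [p' p'P e1] := psP p lp1.
have lp2 : isSome (l2 p) by rewrite -(skel_dom p e12).
have [q' q'P e2] := qsP p lp2.
exists (p', q', spine l1 p).
  by rewrite !allpairs_f // !inE; case: spine.
apply: functional_extensionality => r.
rewrite /F /= /subtree /lsum spine_cat.
have e1' : subtree l1 p = subtree l1 p' by apply: functional_extensionality.
case: (spine l1 p) => /=; last exact: e1.
have -> : spine (fun q => l1 (p' ++ q)) r = spine (subtree l1 p) r by rewrite e1'.
by rewrite (e1 r : l1 (p ++ r) = l1 (p' ++ r)) (e2 r : l2 (p ++ r) = l2 (q' ++ r)).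
Qed.

Lemma subtree_ty (t : ty) p :
  isSome (lab t p) -> exists s, lab s = subtree (lab t) p.
Proof.
case: t => l [l0 lT] [ps psP] /= lp.
have sT : is_tree (subtree l p).
  by split=> [|q i]; rewrite /subtree ?cats0 // -rcons_cat lT.
have sR : is_regular (subtree l p).
  apply: (@regular_of_classes _ ps (subtree l)) => q lq.
  have [p' p'P e] := psP _ lq; exists p' => //.
  apply: functional_extensionality => r.
  by rewrite -e /subtree catA.
by exists (Ty sT sR).
Qed.

(** * Shapes of types, and agreement of [tadd] with the pointwise sum *)

Inductive ty_spec : ty -> Prop :=
| TySpecInt : ty_spec TInt
| TySpecChan k1 k2 t : ty_spec (TChan k1 k2 t)
| TySpecBin o t s : ty_spec (TBin o t s).

(** Types are labellings, so the shape is read off at the root and the components are recovered as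
    subtrees. *)
Lemma tyP t : ty_spec t.
Proof.
have [t0 tT] := lab_tree t.
case tE: (lab t [::]) t0 => [[|k1 k2|o]|] // _.
- suff -> : t = TInt by constructor.
  apply: ty_ext => -[|i p] //=.
  (* [is_tree] extends positions at their end; induction from the right propagates the absence of a
     child of the root to everything below it. *)
  elim/last_ind: p => [|p j IH].
    by move: (tT [::] i); rewrite tE; case: (lab _ _).
  by rewrite -rcons_cons; move: (tT (i :: p) j); rewrite IH; case: (lab _ _).
- have [|s sE] := @subtree_ty t [:: 0]; first by rewrite (tT [::]) tE.
  suff -> : t = TChan k1 k2 s by constructor.
  apply: ty_ext => -[|[|i] p] //=; first by rewrite sE.
  elim/last_ind: p => [|p j IH].
    by move: (tT [::] i.+1); rewrite tE; case: (lab _ _).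
  by rewrite -rcons_cons; move: (tT (i.+1 :: p) j); rewrite IH; case: (lab _ _).
- have [|s sE] := @subtree_ty t [:: 0]; first by rewrite (tT [::]) tE.
  have [|r rE] := @subtree_ty t [:: 1]; first by rewrite (tT [::]) tE.
  suff -> : t = TBin o s r by constructor.
  apply: ty_ext => -[|[|[|i]] p] //=; rewrite ?sE ?rE //.
  elim/last_ind: p => [|p j IH].
    by move: (tT [::] i.+2); rewrite tE; case: (lab _ _).
  by rewrite -rcons_cons; move: (tT (i.+2 :: p) j); rewrite IH; case: (lab _ _).
Qed.

Lemma TChan_inj k1 k2 t k3 k4 s :
  TChan k1 k2 t = TChan k3 k4 s -> [/\ k1 = k3, k2 = k4 & t = s].
Proof.
move=> e; have e' p := congr1 (fun r => lab r p) e.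
have [-> ->] := e' [::]; split=> //; apply: ty_ext => p; exact: (e' (0 :: p)).
Qed.

Lemma TBin_inj o t1 t2 o' s1 s2 :
  TBin o t1 t2 = TBin o' s1 s2 -> [/\ o = o', t1 = s1 & t2 = s2].
Proof.
move=> e; have e' p := congr1 (fun r => lab r p) e.
have [->] := e' [::].
by split=> //; apply: ty_ext => p; [exact: (e' (0 :: p)) | exact: (e' (1 :: p))].
Qed.

(** Only finitely many layers of the coinductive derivation matter at a given position, whence the
    induction on the position. *)
Lemma tadd_lsum t1 t2 s : tadd t1 t2 s ->
  skel (lab t1) = skel (lab t2) /\ lab s = lsum (lab t1) (lab t2).
Proof.
move=> ts; suff H p : skel (lab t1) p = skel (lab t2) p /\
    lab s p = lsum (lab t1) (lab t2) p.
  by split; apply: functional_extensionality => p; have [] := H p.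
elim: p t1 t2 s ts => [|i p IH] _ _ _ [|t k1 k2 k3 k4|o t11 t12 t21 t22 s1 s2 ts1 ts2];
  rewrite /skel /lsum //=.
case: i => [|[|i]]; [exact: IH ts1 | exact: IH ts2 |].
by rewrite /= !if_same.
Qed.

(** One layer of [tadd], with its coinductive premises replaced by the pointwise equations. *)
Inductive lsum_spec : ty -> ty -> ty -> Prop :=
| LSumInt : lsum_spec TInt TInt TInt
| LSumChan t k1 k2 k3 k4 : lsum_spec
    (TChan k1 k2 t) (TChan k3 k4 t) (TChan (uadd k1 k3) (uadd k2 k4) t)
| LSumBin o t11 t12 t21 t22 s1 s2 :
    skel (lab t11) = skel (lab t21) -> lab s1 = lsum (lab t11) (lab t21) ->
    skel (lab t12) = skel (lab t22) -> lab s2 = lsum (lab t12) (lab t22) ->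
    lsum_spec (TBin o t11 t12) (TBin o t21 t22) (TBin o s1 s2).

Lemma lsumP t1 t2 s : skel (lab t1) = skel (lab t2) ->
  lab s = lsum (lab t1) (lab t2) -> lsum_spec t1 t2 s.
Proof.
move=> e eS.
have e' p := congr1 (@^~ p) e; have eS' p := congr1 (@^~ p) eS; move: e' eS'.
rewrite /skel /lsum => e' eS'.
case: (tyP t1) e e' eS eS' => [|k1 k2 t|o t11 t12];
  case: (tyP t2) => [|k3 k4 t'|o' t21 t22];
  case: (tyP s) => [|k5 k6 t''|o'' s1 s2] e e' eS eS';
  try discriminate (e' [::]); try discriminate (eS' [::]).
- exact: LSumInt.
- have [-> ->] := eS' [::].
  have -> : t'' = t by apply: ty_ext => p; exact: (eS' (0 :: p)).
  have -> : t' = t by apply: ty_ext => p; have /= := e' (0 :: p).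
  exact: LSumChan.
- have [?] := e' [::]; have [?] := eS' [::]; subst o' o''.
  apply: LSumBin; apply: functional_extensionality => p.
  + exact: (e' (0 :: p)).
  + exact: (eS' (0 :: p)).
  + exact: (e' (1 :: p)).
  + exact: (eS' (1 :: p)).
Qed.

(** The pointwise equations are stable under unfolding one layer of [tadd], hence contained in it;
    the corecursive calls sit directly under [TABin]. *)
Lemma lsum_tadd t1 t2 s : skel (lab t1) = skel (lab t2) ->
  lab s = lsum (lab t1) (lab t2) -> tadd t1 t2 s.
Proof.
move: t1 t2 s; cofix CIH => t1 t2 s e eS.
case: (lsumP e eS) => [|t k1 k2 k3 k4|o t11 t12 t21 t22 s1 s2 e1 eS1 e2 eS2].
- exact: TAInt.
- exact: TAChan.
- by apply: TABin; exact: CIH.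
Qed.

Lemma taddC t1 t2 s : tadd t1 t2 s -> tadd t2 t1 s.
Proof.
by case/tadd_lsum=> e eS; apply: lsum_tadd; rewrite ?eS // lsumC.
Qed.

(** The missing sum of [t2] and [t3] is built by [lsum]. Their skeletons agree because [s] has the
    skeleton of both [t1] and [t3]. *)
Lemma taddA t1 t2 s t3 r : tadd t1 t2 s -> tadd s t3 r ->
  exists2 q, tadd t2 t3 q & tadd t1 q r.
Proof.
case/tadd_lsum=> e12 eS /tadd_lsum[eS3 eR].
have e23 : skel (lab t2) = skel (lab t3) by rewrite -eS3 eS skel_lsum.
pose q := Ty (lsum_tree (lab t3) (lab_tree t2))
  (lsum_regular e23 (lab_regular t2) (lab_regular t3)).
exists q; first exact: lsum_tadd.
apply: lsum_tadd; first by rewrite skel_lsum.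
by rewrite eR eS /= lsumA.
Qed.

(** Since types are records, impossible cases are refuted by comparing the labels at the root. *)
Lemma tadd_chan k1 k2 t t' s : tadd (TChan k1 k2 t) t' s ->
  exists k3 k4, t' = TChan k3 k4 t /\ s = TChan (uadd k1 k3) (uadd k2 k4) t.
Proof.
move e: (TChan k1 k2 t) => r H; case: H e.
- by move=> e; have := congr1 (fun r => lab r [::]) e.
- by move=> t0 ? ? k3 k4 /TChan_inj[<- <- <-]; exists k3, k4.
- by move=> > _ _ e; have := congr1 (fun r => lab r [::]) e.
Qed.

Lemma tadd_bin o t1 t2 t' s : tadd (TBin o t1 t2) t' s ->
  exists t1' t2' s1 s2, [/\ t' = TBin o t1' t2', s = TBin o s1 s2,
    tadd t1 t1' s1 & tadd t2 t2' s2].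
Proof.
move e: (TBin o t1 t2) => r H; case: H e.
- by move=> e; have := congr1 (fun r => lab r [::]) e.
- by move=> > e; have := congr1 (fun r => lab r [::]) e.
- by move=> ? ? ? t1' t2' s1 s2 H1 H2 /TBin_inj[-> -> ->]; exists t1', t2', s1, s2.
Qed.

Lemma un_bin o t s : un (TBin o t s) <-> un t /\ un s.
Proof.
split=> [|[ut us]]; last exact: TABin.
case/tadd_bin=> [t1 [t2 [s1 [s2 [e1 e2]]]]].
by case: (TBin_inj e1) (TBin_inj e2) => _ <- <- [_ <- <-].
Qed.

Lemma tadd_to_bin o t1 t2 s1 s2 : tadd t1 t2 (TBin o s1 s2) ->
  exists t11 t12 t21 t22, [/\ t1 = TBin o t11 t12, t2 = TBin o t21 t22,
    tadd t11 t21 s1 & tadd t12 t22 s2].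
Proof.
move e: (TBin o s1 s2) => r H; case: H e.
- by move=> e; have := congr1 (fun r => lab r [::]) e.
- by move=> > e; have := congr1 (fun r => lab r [::]) e.
- by move=> ? t11 t12 t21 t22 ? ? H1 H2 /TBin_inj[-> -> ->]; exists t11, t12, t21, t22.
Qed.

Lemma tadd_to_int t1 t2 : tadd t1 t2 TInt -> t1 = TInt /\ t2 = TInt.
Proof.
move e: TInt => r H; case: H e => //.
- by move=> > e; have := congr1 (fun r => lab r [::]) e.
- by move=> > _ _ e; have := congr1 (fun r => lab r [::]) e.
Qed.

(** On the spine, unlimited means that each use is idempotent, and idempotent uses are closed under
    addition. *)
Lemma tadd_un t s r : un t -> un s -> tadd t s r -> un r.
Proof.
move=> ut us tsr.
have [_ et] := tadd_lsum ut; have [_ es] := tadd_lsum us.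
have [e er] := tadd_lsum tsr; apply: lsum_tadd => //.
apply: functional_extensionality => p.
have := congr1 (@^~ p) et; have := congr1 (@^~ p) es; rewrite er.
rewrite !lsumE spine_lsum -(skel_spine p e).
case: (spine _ p) => //.
case: (lab t p) (lab s p) => [[|k1 k2|?]|] [[|k3 k4|?]|] //= [e3 e4] [e1 e2].
by case: k1 k2 k3 k4 e1 e2 e3 e4 => [] [] [] [].
Qed.

(** A doubled use is 0 or omega, and both are idempotent. *)
Lemma un_chan2 k1 k2 t : un (TChan (uadd k1 k1) (uadd k2 k2) t).
Proof.
have := TAChan t (uadd k1 k1) (uadd k2 k2) (uadd k1 k1) (uadd k2 k2).
by case: k1; case: k2.
Qed.

(** * Combination of environments *)

(** The condition of [envadd] at one name, an absent entry being neutral; the laws of [envadd] are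
    proved name by name through it. *)
Definition oadd (o1 o2 o : option ty) : Prop :=
  match o1, o2 with
  | Some t1, Some t2 => exists2 t, tadd t1 t2 t & o = Some t
  | Some t1, None => o = Some t1
  | None, Some t2 => o = Some t2
  | None, None => o = None
  end.

Lemma oaddC o1 o2 o : oadd o1 o2 o -> oadd o2 o1 o.
Proof. by case: o1 o2 => [t1|] [t2|] //= [t /taddC]; exists t. Qed.

Lemma oadd0 o1 o : oadd o1 None o <-> o = o1.
Proof. by case: o1. Qed.

Lemma oaddA o1 o2 o12 o3 o : oadd o1 o2 o12 -> oadd o12 o3 o ->
  exists2 o23, oadd o2 o3 o23 & oadd o1 o23 o.
Proof.
case: o1 o2 o3 => [t1|] [t2|] [t3|] /=.
- case=> t12 H12 -> [t H ->]; have [t23 H23 H1] := taddA H12 H.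
  by exists (Some t23); [exists t23 | exists t].
- by case=> t12 H12 -> -> /=; exists (Some t2) => //; exists t12.
- by move=> -> [t H ->]; exists (Some t3) => //; exists t.
- by move=> -> /= ->; exists None.
- by move=> -> [t H ->]; exists (Some t) => //; exists t.
- by move=> -> ->; exists (Some t2).
- by move=> -> ->; exists (Some t3).
- by move=> -> ->; exists None.
Qed.

(** Finite choice: sums of types are only known to exist name by name, and this assembles them into
    an environment. *)
Lemma env_choice (R : name -> option ty -> Prop) (S : seq name) :
  (forall u, u \in S -> exists o, R u o) ->
  exists G : env, forall u, (u \in S -> R u G.[? u]) /\
                            (u \notin S -> G.[? u] = None).
Proof.
elim: S => [|v S IH] RS.
  by exists [fmap] => u; split=> // _; rewrite fnd_fmap0.
have [|G GP] := IH; first by move=> u uS; apply: RS; rewrite inE uS orbT.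
have [o vo] := RS v (mem_head _ _).
(* The chosen entry may be absent, in which case [v] has to be removed. *)
pose H : env := if o is Some t then G.[v <- t] else G.[~ v].
exists H => u; have -> : H.[? u] = if u == v then o else G.[? u].
  by rewrite /H; case: (o) => [t|]; rewrite ?fnd_set ?fnd_rem1 //; case: (u == v).
rewrite inE; case: eqP => [-> //|_] /=; exact: GP.
Qed.

Lemma fnd_None (G : env) u : (G.[? u] = None) <-> u \notin domf G.
Proof. by split=> [|/not_fnd //]; case: fndP. Qed.

Lemma env_ext (G H : env) : (forall u, G.[? u] = H.[? u]) -> G = H.
Proof. by move/fmapP. Qed.

Lemma envaddC A B G : envadd A B G -> envadd B A G.
Proof. by move=> H u; apply: oaddC (H u). Qed.

Lemma envadd0 G : envadd G [fmap] G.
Proof. by move=> u; rewrite fnd_fmap0; case: (G.[? u]). Qed.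

Lemma envaddA A B X C G : envadd A B X -> envadd X C G ->
  exists2 Y, envadd B C Y & envadd A Y G.
Proof.
move=> HX HG.
have [|Y YP] := @env_choice (fun u o => oadd B.[? u] C.[? u] o /\
   oadd A.[? u] o G.[? u]) (domf B `|` domf C).
  by move=> u _; have [o] := oaddA (HX u) (HG u); exists o.
have {}YP u : oadd B.[? u] C.[? u] Y.[? u] /\ oadd A.[? u] Y.[? u] G.[? u].
  have [Y1 Y2] := YP u; have [/Y1 //|uN] := boolP (u \in domf B `|` domf C).
  rewrite (Y2 uN); move: uN (HX u) (HG u).
  rewrite inE negb_or => /andP[/not_fnd-> /not_fnd->] /oadd0-> /oadd0->.
  by split=> //; apply/oadd0.
by exists Y => u; have [] := YP u.
Qed.

Lemma envaddAC A B X C G : envadd A B X -> envadd X C G ->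
  exists2 Y, envadd A C Y & envadd Y B G.
Proof.
move=> HX HG; have [Y HY HG'] := envaddA (envaddC HX) HG.
by exists Y => //; exact: envaddC.
Qed.

Lemma envaddCA A B C Y G : envadd B C Y -> envadd A Y G ->
  exists2 X, envadd A B X & envadd X C G.
Proof.
move=> HY HG; have [X HX HG'] := envaddAC HY (envaddC HG).
have [Z HZ HG''] := envaddA (envaddC HX) HG'.
have [Z' HZ' HG3] := envaddA (envaddC HZ) (envaddC HG'').
have [Z2 HZ2 HG4] := envaddA (envaddC HZ') (envaddC HG3).
by exists X; first exact: envaddC.
Qed.

(** Interchange: two split environments are regrouped componentwise, for instance into the subjects
    of a communication on one side and its message and continuation on the other. *)
Lemma envaddACA A B X C D Y G :
  envadd A B X -> envadd C D Y -> envadd X Y G ->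
  exists U V, [/\ envadd A C U, envadd B D V & envadd U V G].
Proof.
move=> HX HY HG; have [Z HZ HG1] := envaddCA HY HG.
have [U HU HZ1] := envaddAC HX HZ.
by have [V HV HG2] := envaddA HZ1 HG1; exists U, V.
Qed.

Lemma envadd_rem u A B G : envadd A B G -> envadd A.[~ u] B.[~ u] G.[~ u].
Proof. by move=> H v; rewrite !fnd_rem1; case: (v == u) (H v). Qed.

Lemma envadd_setl u t A B G :
  envadd A B G -> B.[? u] = None -> envadd A.[u <- t] B G.[u <- t].
Proof.
move=> H Bu v; rewrite !fnd_set; case: eqP => [-> |_]; last exact: H.
by rewrite Bu.
Qed.

Lemma rem_set (G : env) u t : G.[? u] = Some t -> G = G.[~ u].[u <- t].
Proof.
move=> Gu; apply: env_ext => v; rewrite fnd_set fnd_rem1.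
by case: eqP => [->|].
Qed.

Lemma set_rem (G : env) u t : G.[? u] = None -> G.[u <- t].[~ u] = G.
Proof.
move=> Gu; apply: env_ext => v; rewrite fnd_rem1 fnd_set.
by case: eqP => [->|].
Qed.

Lemma rem_None (G : env) u : G.[? u] = None -> G.[~ u] = G.
Proof. by move=> Gu; apply: env_ext => v; rewrite fnd_rem1; case: eqP => [->|]. Qed.

Lemma unenv0 : unenv [fmap].
Proof. by move=> u t; rewrite fnd_fmap0. Qed.

Lemma unenv_add A B G : unenv A -> unenv B -> envadd A B G -> unenv G.
Proof.
move=> uA uB H u t; have := H u.
case EA: A.[? u] => [t1|]; case EB: B.[? u] => [t2|] /=.
- by case=> s Hs -> [<-]; exact: tadd_un (uA _ _ EA) (uB _ _ EB) Hs.
- by move=> -> [<-]; exact: uA EA.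
- by move=> -> [<-]; exact: uB EB.
- by move=> ->.
Qed.

Lemma unenv_rem u G : unenv G -> unenv G.[~ u].
Proof. by move=> uG v t; rewrite fnd_rem1; case: (v == u) => //=; exact: uG. Qed.

Lemma unenv_dup G : unenv G -> envadd G G G.
Proof.
move=> uG u; case E: G.[? u] => [t|] //.
by exists t => //; exact: uG E.
Qed.

(** * Weakening by unlimited resources *)

Definition wk (G G' : env) : Prop := exists2 G0, unenv G0 & envadd G G0 G'.

Lemma wk_refl G : wk G G.
Proof. by exists [fmap]; [exact: unenv0 | exact: envadd0]. Qed.

Lemma wk_trans A B C : wk A B -> wk B C -> wk A C.
Proof.
move=> [X uX HX] [Y uY HY]; have [Z HZ HC] := envaddA HX HY.
by exists Z => //; exact: unenv_add HZ.
Qed.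

Lemma wk_un G G' : unenv G -> wk G G' -> unenv G'.
Proof. by move=> uG [X uX HX]; exact: unenv_add HX. Qed.

(** The surplus of one summand can be moved out of the sum. Such a surplus may extend the domain or
    raise uses of names already present. *)
Lemma wk_addl A A' B G : wk A A' -> envadd A' B G ->
  exists2 H, envadd A B H & wk H G.
Proof.
by move=> [X uX HX] HG; have [H H1 H2] := envaddAC HX HG; exists H => //; exists X.
Qed.

Lemma wk_add A A' B B' G : wk A A' -> wk B B' -> envadd A' B' G ->
  exists2 H, envadd A B H & wk H G.
Proof.
move=> wA wB HG; have [H H1 H2] := wk_addl wA HG.
have [K K1 K2] := wk_addl wB (envaddC H1).
by exists K; [exact: envaddC | exact: wk_trans K2 H2].
Qed.

(** Conversely, the surplus of a sum can be charged entirely to its second summand. *)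
Lemma add_wk A B B' G : envadd A B G -> wk G B' -> exists2 H, wk B H & envadd A H B'.
Proof.
by move=> HG [X uX HX]; have [H H1 H2] := envaddA HG HX; exists H => //; exists X.
Qed.

Lemma wk_set u t G G' : wk G G' -> G'.[? u] = None -> wk G.[u <- t] G'.[u <- t].
Proof.
move=> [X uX HX] G'u; exists X => //; apply: envadd_setl => //.
have := HX u; rewrite G'u.
by case: (G.[? u]) (X.[? u]) => [?|] [?|] //= [].
Qed.

(** Meant for involutions [f], for which the entry at [u] is that of [G] at [f u] and the default
    [TInt] is never reached. *)
Definition renenv (f : name -> name) (G : env) : env :=
  [fmap u : f @` domf G => odflt TInt G.[? f (val u)]].

Section Renaming.
Variables (f : name -> name) (fK : involutive f).

Lemma fnd_ren G u : (renenv f G).[? u] = G.[? f u].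
Proof.
have mem v : (v \in f @` domf G) = (f v \in domf G).
  apply/imfsetP/idP => [[w /= wG ->]|vG]; first by rewrite fK.
  by exists (f v); rewrite ?fK.
case: fndP => [uG|] /=.
  rewrite ffunE /=; case E: G.[? f u] => //=.
  by move: uG => /=; rewrite mem; move/fnd_None: E => /negbTE->.
by rewrite mem => /not_fnd.
Qed.

Lemma renK : involutive (renenv f).
Proof. by move=> G; apply: env_ext => u; rewrite !fnd_ren fK. Qed.

Lemma ren_set G u t : renenv f G.[u <- t] = (renenv f G).[f u <- t].
Proof.
apply: env_ext => v; rewrite fnd_ren !fnd_set fnd_ren.
by rewrite -(inj_eq (inv_inj fK)) fK.
Qed.

Lemma envadd_ren A B G : envadd A B G ->
  envadd (renenv f A) (renenv f B) (renenv f G).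
Proof. by move=> H u; rewrite !fnd_ren; exact: H. Qed.

Lemma unenv_ren G : unenv G -> unenv (renenv f G).
Proof. by move=> uG u t; rewrite fnd_ren; exact: uG. Qed.

End Renaming.

(** Bound names are changed by transpositions, which are involutions and so can be undone without
    freshness conditions. *)
Definition nswap (u w z : name) : name :=
  if z == u then w else if z == w then u else z.

Lemma nswapK u w : involutive (nswap u w).
Proof.
move=> z; rewrite /nswap; case: (z =P u) => [->|zu].
  by rewrite eqxx; case: eqP.
case: (z =P w) => [->|/eqP/negbTE zw]; first by rewrite eqxx.
by rewrite zw; move/eqP/negbTE: zu => ->.
Qed.

Lemma nswapL u w : nswap u w u = w.
Proof. by rewrite /nswap eqxx. Qed.

Lemma nswapD u w z : z != u -> z != w -> nswap u w z = z.
Proof. by rewrite /nswap => /negbTE-> /negbTE->. Qed.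

Lemma ren_swap_set (G : env) u w t : G.[? u] = None -> G.[? w] = None ->
  renenv (nswap u w) G.[u <- t] = G.[w <- t].
Proof.
move=> Gu Gw; rewrite (ren_set (@nswapK _ _)) nswapL; apply: env_ext => z.
rewrite !fnd_set (fnd_ren (@nswapK _ _)) /nswap.
case: (z =P w) => // zw; case: (z =P u) => [->|] //.
by rewrite Gw Gu.
Qed.

Lemma Chan_inj : injective Chan.
Proof. by move=> a b []. Qed.

Lemma Var_inj : injective Var.
Proof. by move=> x y []. Qed.

Lemma fresh (S : {fset name}) (f : nat -> name) : injective f -> exists n, f n \notin S.
Proof.
move=> fI; apply: NNPP => no.
have sub : {subset [seq f i | i <- iota 0 #|` S|.+1] <= enum_fset S}.
  move=> _ /mapP[i _ ->]; apply: contraT => fN.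
  by case: no; exists i.
have := uniq_leq_size _ sub.
by rewrite map_inj_uniq // iota_uniq size_map size_iota ltnn => /(_ isT).
Qed.

(** * Opening and renaming of processes *)

(** The left inverse of [eclose]: the outermost binder has the greatest index, [ord_max], and
    [unlift] returns the other indices to the smaller range. *)
Fixpoint eopen n (u : name) (e : expr n.+1) : expr n :=
  match e with
  | EInt k => EInt k
  | EName w => EName w
  | EBound i => if unlift ord_max i is Some j then EBound j else EName u
  | EPair e1 e2 => EPair (eopen u e1) (eopen u e2)
  | EFst e1 => EFst (eopen u e1)
  | ESnd e1 => ESnd (eopen u e1)
  | EInl e1 => EInl (eopen u e1)
  | EInr e1 => EInr (eopen u e1)
  end.

Fixpoint popen n (u : name) (P : proc n.+1) : proc n :=
  match P with
  | PIdle => PIdle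
  | PInB e Q => PInB (eopen u e) (popen u Q)
  | POut e f => POut (eopen u e) (eopen u f)
  | PPar Q1 Q2 => PPar (popen u Q1) (popen u Q2)
  | PRep Q => PRep (popen u Q)
  | PNewB Q => PNewB (popen u Q)
  | PCaseB e Q1 Q2 => PCaseB (eopen u e) (popen u Q1) (popen u Q2)
  end.

Fixpoint eren n (f : name -> name) (e : expr n) : expr n :=
  match e with
  | EInt k => EInt k
  | EName w => EName (f w)
  | EBound i => EBound i
  | EPair e1 e2 => EPair (eren f e1) (eren f e2)
  | EFst e1 => EFst (eren f e1)
  | ESnd e1 => ESnd (eren f e1)
  | EInl e1 => EInl (eren f e1)
  | EInr e1 => EInr (eren f e1)
  end.

Fixpoint pren n (f : name -> name) (P : proc n) : proc n :=
  match P with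
  | PIdle => PIdle
  | PInB e Q => PInB (eren f e) (pren f Q)
  | POut e g => POut (eren f e) (eren f g)
  | PPar Q1 Q2 => PPar (pren f Q1) (pren f Q2)
  | PRep Q => PRep (pren f Q)
  | PNewB Q => PNewB (pren f Q)
  | PCaseB e Q1 Q2 => PCaseB (eren f e) (pren f Q1) (pren f Q2)
  end.

Lemma widen_lift n (i : 'I_n) : widen_ord (leqnSn n) i = lift ord_max i.
Proof. by apply: val_inj; exact: esym (lift_max i). Qed.

Lemma eopen_eclose n u (e : expr n) : eopen u (eclose u e) = e.
Proof.
elim: e => //= [w|i|e1 -> e2 ->|e ->|e ->|e ->|e ->] //.
  by case: eqP => [->|] //=; rewrite unlift_none.
by rewrite widen_lift liftK.
Qed.

Lemma popen_pclose n u (P : proc n) : popen u (pclose u P) = P.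
Proof. by elim: P => //= *; rewrite ?eopen_eclose; congruence. Qed.

Lemma eopen_eclose_swap n u w (e : expr n) : w \notin efn e ->
  eopen w (eclose u e) = eren (nswap u w) e.
Proof.
elim: e => //= [z|i|e1 IH1 e2 IH2|e IH|e IH|e IH|e IH].
- rewrite inE eq_sym => zw; case: (z =P u) => [->|/eqP zu] /=.
    by rewrite unlift_none nswapL.
  by rewrite nswapD.
- by move=> _; rewrite widen_lift liftK.
- by rewrite inE negb_or => /andP[/IH1-> /IH2->].
- by move/IH->.
- by move/IH->.
- by move/IH->.
- by move/IH->.
Qed.

(** Closing [u] and opening with a fresh [w] replaces [u] by [w]; as [w] does not occur, this is a
    transposition. Questions about bound names are thereby reduced to equivariance. *)
Lemma popen_pclose_swap n u w (P : proc n) : w \notin fn P ->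
  popen w (pclose u P) = pren (nswap u w) P.
Proof.
elim: P => {n} [n|n e P IH|n e f|n P IHP Q IHQ|n P IH|n P IH|n e P IHP Q IHQ] //=;
  rewrite ?inE ?negb_or.
- by case/andP=> ? /IH->; rewrite eopen_eclose_swap.
- by case/andP=> ? ?; rewrite !eopen_eclose_swap.
- by case/andP=> /IHP-> /IHQ->.
- by move/IH->.
- by move/IH->.
- by case/and3P=> ? /IHP-> /IHQ->; rewrite eopen_eclose_swap.
Qed.

Lemma eclose_eopen n u (e : expr n.+1) : u \notin efn e ->
  eclose u (eopen u e) = e.
Proof.
elim: e => //= [z|i|e1 IH1 e2 IH2|e IH|e IH|e IH|e IH].
- by rewrite inE eq_sym => /negbTE->.
- move=> _; case: unliftP => [j ->|->] /=; first by rewrite widen_lift.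
  by rewrite eqxx.
- by rewrite inE negb_or => /andP[/IH1-> /IH2->].
- by move/IH->.
- by move/IH->.
- by move/IH->.
- by move/IH->.
Qed.

(** Opening is defined at successor indices only, so the induction has to range over processes with
    at least one dangling index. *)
Lemma procS_ind (T : forall n, proc n.+1 -> Prop) :
  (forall n, T n PIdle) ->
  (forall n e P, T n.+1 P -> T n (PInB e P)) ->
  (forall n e f, T n (POut e f)) ->
  (forall n P Q, T n P -> T n Q -> T n (PPar P Q)) ->
  (forall n P, T n P -> T n (PRep P)) ->
  (forall n P, T n.+1 P -> T n (PNewB P)) ->
  (forall n e P Q, T n.+1 P -> T n.+1 Q -> T n (PCaseB e P Q)) ->
  forall n P, T n P.
Proof.
move=> HI HIn HO HP HR HN HC; fix IH 2 => n [|e P|e f|P Q|P|P|e P Q];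
  [exact: HI|apply: HIn|exact: HO|apply: HP|apply: HR|apply: HN|apply: HC];
  exact: IH.
Qed.

Lemma pclose_popen n u (P : proc n.+1) : u \notin fn P ->
  pclose u (popen u P) = P.
Proof.
elim/procS_ind: n / P
  => [n|n e P IH|n e f|n P Q IHP IHQ|n P IH|n P IH|n e P Q IHP IHQ] //=;
  rewrite ?inE ?negb_or.
- by case/andP=> ? /IH->; rewrite eclose_eopen.
- by case/andP=> ? ?; rewrite !eclose_eopen.
- by case/andP=> /IHP-> /IHQ->.
- by move/IH->.
- by move/IH->.
- by case/and3P=> ? /IHP-> /IHQ->; rewrite eclose_eopen.
Qed.

Lemma popen_swap n u w (P : proc n.+1) : u \notin fn P -> w \notin fn (popen u P) ->
  popen w P = pren (nswap u w) (popen u P).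
Proof. by move=> uP wP; rewrite -popen_pclose_swap // pclose_popen. Qed.

Lemma eren_eopen n f u (e : expr n.+1) : eren f (eopen u e) = eopen (f u) (eren f e).
Proof.
by elim: e => //= [i|e1 -> e2 ->|e ->|e ->|e ->|e ->] //; case: unlift.
Qed.

Lemma pren_popen n f u (P : proc n.+1) : pren f (popen u P) = popen (f u) (pren f P).
Proof.
by elim/procS_ind: n / P => //= *; rewrite ?eren_eopen; congruence.
Qed.

Lemma pren_pclose n f u (P : proc n) : injective f ->
  pren f (pclose u P) = pclose (f u) (pren f P).
Proof.
move=> fI; have E m (e : expr m) : eren f (eclose u e) = eclose (f u) (eren f e).
  elim: e => //= [w|e1 -> e2 ->|e ->|e ->|e ->|e ->] //.
  by rewrite (inj_eq fI); case: eqP.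
by elim: P => //= *; rewrite ?E; congruence.
Qed.

Lemma eq_eren n f g (e : expr n) : {in efn e, f =1 g} -> eren f e = eren g e.
Proof.
elim: e => //= [u|e1 IH1 e2 IH2|e IH|e IH|e IH|e IH] fg;
  rewrite ?IH ?IH1 ?IH2 ?fg ?inE //.
- by move=> x xe; apply: fg; rewrite inE xe orbT.
- by move=> x xe; apply: fg; rewrite inE xe.
Qed.

Lemma eq_pren n f g (P : proc n) : {in fn P, f =1 g} -> pren f P = pren g P.
Proof.
elim: P => {n} [n|n e P IH|n e e'|n P IHP Q IHQ|n P IH|n P IH|n e P IHP Q IHQ] //= fg.
- by rewrite IH ?(@eq_eren _ f g) // => x xe; apply: fg; rewrite inE xe ?orbT.
- by rewrite !(@eq_eren _ f g) // => x xe; apply: fg; rewrite inE xe ?orbT.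
- by rewrite IHP ?IHQ // => x xe; apply: fg; rewrite inE xe ?orbT.
- by rewrite IH.
- by rewrite IH.
- by rewrite IHP ?IHQ ?(@eq_eren _ f g) // => x xe; apply: fg; rewrite !inE xe ?orbT.
Qed.

Lemma pren_id n (P : proc n) : pren id P = P.
Proof.
have E m (e : expr m) : eren id e = e by elim: e => //= *; congruence.
by elim: P => //= *; rewrite ?E; congruence.
Qed.

Lemma pren_comp n f g (P : proc n) : pren f (pren g P) = pren (f \o g) P.
Proof.
have E m (e : expr m) : eren f (eren g e) = eren (f \o g) e.
  by elim: e => //= *; congruence.
by elim: P => //= *; rewrite ?E; congruence.
Qed.

Lemma prenK n f (P : proc n) : involutive f -> pren f (pren f P) = P.
Proof.
by move=> fK; rewrite pren_comp -[RHS]pren_id; apply: eq_pren => u _ /=; rewrite fK.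
Qed.

Lemma pren_swap_fresh n u w (P : proc n) : u \notin fn P -> w \notin fn P ->
  pren (nswap u w) P = P.
Proof.
move=> uP wP; rewrite -[RHS]pren_id; apply: eq_pren => z zP.
by rewrite nswapD //; [apply: contraNneq uP => <- | apply: contraNneq wP => <-].
Qed.

Lemma efn_eren n f z (e : expr n) : involutive f ->
  (z \in efn (eren f e)) = (f z \in efn e).
Proof.
move=> fK; elim: e => //= [u|e1 IH1 e2 IH2]; last by rewrite !inE IH1 IH2.
by rewrite !inE -(inj_eq (inv_inj fK)) fK.
Qed.

Lemma fn_pren n f z (P : proc n) : involutive f ->
  (z \in fn (pren f P)) = (f z \in fn P).
Proof.
move=> fK; have E m (e : expr m) := @efn_eren m f z e fK.
elim: P => //= [m e P IH|m e g|m P IHP Q IHQ|m e P IHP Q IHQ].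
- by rewrite !inE E IH.
- by rewrite !inE !E.
- by rewrite !inE IHP IHQ.
- by rewrite !inE E IHP IHQ.
Qed.

Lemma fn_pclose n u z (P : proc n) : z \in fn (pclose u P) -> z \in fn P.
Proof.
have E m (e : expr m) : z \in efn (eclose u e) -> z \in efn e.
  elim: e => //= [w|e1 IH1 e2 IH2]; first by case: ifP.
  by rewrite !inE => /orP[/IH1->|/IH2->]; rewrite ?orbT.
elim: P => //= [m e P IH|m e f|m P IHP Q IHQ|m e P IHP Q IHQ]; rewrite !inE.
- by case/orP=> [/E->|/IH->]; rewrite ?orbT.
- by case/orP=> /E->; rewrite ?orbT.
- by case/orP=> [/IHP->|/IHQ->]; rewrite ?orbT.
- by case/or3P=> [/E->|/IHP->|/IHQ->]; rewrite ?orbT.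
Qed.

Lemma fn_popen n u z (P : proc n.+1) : z \in fn (popen u P) -> z = u \/ z \in fn P.
Proof.
have E m (e : expr m.+1) : z \in efn (eopen u e) -> z = u \/ z \in efn e.
  elim: e => //= [w|i|e1 IH1 e2 IH2]; first by right.
    by case: unlift => //= ; rewrite inE => /eqP; left.
  by rewrite !inE => /orP[/IH1|/IH2] [->|->]; rewrite ?orbT; auto.
elim/procS_ind: n / P => //= [m e P IH|m e f|m P Q IHP IHQ|m e P Q IHP IHQ]; rewrite !inE.
- by case/orP=> [/E|/IH] [->|->]; rewrite ?orbT; auto.
- by case/orP=> /E [->|->]; rewrite ?orbT; auto.
- by case/orP=> [/IHP|/IHQ] [->|->]; rewrite ?orbT; auto.
- by case/or3P=> [/E|/IHP|/IHQ] [->|->]; rewrite ?orbT; auto.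
Qed.

Lemma eopen_eweaken n u (v : expression) : eopen u (eweaken n.+1 v) = eweaken n v.
Proof. by elim: v => //= [[]|e1 -> e2 ->|e ->|e ->|e ->|e ->]. Qed.

Lemma eweaken0 (v : expression) : eweaken 0 v = v.
Proof. by elim: v => //= [[]|e1 -> e2 ->|e ->|e ->|e ->|e ->]. Qed.

(** The substituted [v] has no dangling index for the opening to act on. *)
Lemma psubst_popen n x v u (P : proc n.+1) : u != Var x ->
  psubst x v (popen u P) = popen u (psubst x v P).
Proof.
move=> ux; have E m (e : expr m.+1) : esubst x v (eopen u e) = eopen u (esubst x v e).
  elim: e => //= [w|i|e1 -> e2 ->|e ->|e ->|e ->|e ->] //.
    by case: ifP => // _; rewrite eopen_eweaken.
  by case: unlift => //=; rewrite (negbTE ux).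
by elim/procS_ind: n / P => //= *; rewrite ?E; congruence.
Qed.

Lemma psubst_swap n x y v (P : proc n) : Var y \notin fn P ->
  psubst y v (pren (nswap (Var x) (Var y)) P) = psubst x v P.
Proof.
have E m (e : expr m) : Var y \notin efn e ->
    esubst y v (eren (nswap (Var x) (Var y)) e) = esubst x v e.
  elim: e => //= [z|e1 IH1 e2 IH2|e IH|e IH|e IH|e IH].
  - rewrite inE eq_sym => zy; rewrite /nswap; case: (z =P Var x) => _.
      by rewrite eqxx.
    by rewrite !(negbTE zy).
  - by rewrite inE negb_or => /andP[/IH1-> /IH2->].
  - by move/IH->.
  - by move/IH->.
  - by move/IH->.
  - by move/IH->.
elim: P => {n} [n|n e P IH|n e f|n P IHP Q IHQ|n P IH|n P IH|n e P IHP Q IHQ] //=;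
  rewrite ?inE ?negb_or.
- by case/andP=> ? /IH->; rewrite E.
- by case/andP=> ? ?; rewrite !E.
- by case/andP=> /IHP-> /IHQ->.
- by move/IH->.
- by move/IH->.
- by case/and3P=> ? /IHP-> /IHQ->; rewrite E.
Qed.

(** * Typing of expressions *)

Lemma etyping_name_inv G u t : etyping G (EName u) t ->
  G.[? u] = Some t /\ unenv G.[~ u].
Proof.
move eE: (EName u) => e H; case: H eE => // {}G w {}t uG wG [->].
by rewrite set_rem ?fnd_set ?eqxx //; apply/fnd_None.
Qed.

Lemma etyping_name (G : env) u t : G.[? u] = Some t -> unenv G.[~ u] ->
  etyping G (EName u) t.
Proof.
move=> Gu uG; rewrite (rem_set Gu); apply: TEName => //.
by apply/fnd_None; rewrite fnd_rem1 eqxx.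
Qed.

Lemma etyping_ren f G e t : involutive f -> etyping G e t ->
  etyping (renenv f G) (eren f e) t.
Proof.
move=> fK; elim=> {G e t}.
- by move=> G k uG; apply: TEInt; exact: unenv_ren.
- move=> G u t uG /fnd_None uN; rewrite ren_set //; apply: TEName.
    exact: unenv_ren.
  by apply/fnd_None; rewrite fnd_ren // fK.
- by move=> *; exact: TEInl.
- by move=> *; exact: TEInr.
- by move=> G1 G2 G e1 e2 t1 t2 _ H1 _ H2 HG; apply: TEPair H1 H2 _; exact: envadd_ren.
- by move=> G e t s _ H us; exact: TEFst us.
- by move=> G e t s _ H us; exact: TESnd us.
Qed.

(** This permits discarding a value of unlimited type together with all the resources it holds. *)
Lemma value_un G v t : etyping G v t -> value v -> un t -> unenv G.
Proof.
elim=> {G v t} //=.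
- move=> G u t uG _ _ ut w s; rewrite fnd_set.
  by case: (w == u) => [[<-]|]; [exact: ut | exact: uG].
- by move=> G e t s _ IH ve /un_bin[ut us]; exact: IH.
- by move=> G e t s _ IH ve /un_bin[ut us]; exact: IH.
- move=> G1 G2 G e1 e2 t1 t2 _ IH1 _ IH2 HG /andP[v1 v2] /un_bin[u1 u2].
  by apply: unenv_add HG; [exact: IH1 | exact: IH2].
Qed.

(** A variable may be shared among several subterms, each with a part of its type; the resources of
    the value substituted for it must split in the same way. *)
Lemma value_split G v t t1 t2 : etyping G v t -> value v -> tadd t1 t2 t ->
  exists G1 G2, [/\ etyping G1 v t1, etyping G2 v t2 & envadd G1 G2 G].
Proof.
move=> H; elim: H t1 t2 => {G v t} //=.
- move=> G k uG t1 t2 _ /tadd_to_int[-> ->].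
  by exists G, G; split; [exact: TEInt | exact: TEInt | exact: unenv_dup].
(* Only the entry of [u] is divided; the unlimited remainder goes to both sides. *)
- move=> G u t uG uN t1 t2 _ tt; exists G.[u <- t1], G.[u <- t2].
  split; [exact: TEName | exact: TEName |] => w; rewrite !fnd_set.
  by case: (w == u); [exists t | exact: (unenv_dup uG w)].
- move=> G e t s _ IH t1 t2 ve /tadd_to_bin[t11 [t12 [t21 [t22 [-> -> H1 _]]]]].
  have [G1 [G2 [T1 T2 HG]]] := IH _ _ ve H1.
  by exists G1, G2; split=> //; exact: TEInl.
- move=> G e t s _ IH t1 t2 ve /tadd_to_bin[t11 [t12 [t21 [t22 [-> -> _ H2]]]]].
  have [G1 [G2 [T1 T2 HG]]] := IH _ _ ve H2.
  by exists G1, G2; split=> //; exact: TEInr.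
- move=> A B G e1 e2 t s _ IH1 _ IH2 HG t1 t2 /andP[v1 v2].
  case/tadd_to_bin=> [t11 [t12 [t21 [t22 [-> -> H1 H2]]]]].
  have [A1 [A2 [TA1 TA2 HA]]] := IH1 _ _ v1 H1.
  have [B1 [B2 [TB1 TB2 HB]]] := IH2 _ _ v2 H2.
  have [U [V [HU HV HG']]] := envaddACA HA HB HG.
  by exists U, V; split; [exact: TEPair HU | exact: TEPair HV |].
Qed.

Lemma etyping_pair_inv G v w t s : etyping G (EPair v w) (TBin Times t s) ->
  exists G1 G2, [/\ etyping G1 v t, etyping G2 w s & envadd G1 G2 G].
Proof.
move er: (TBin Times t s) => r; move ee: (EPair v w) => e H; case: H er ee => //.
by move=> {}G1 G2 {}G e1 e2 t1 t2 H1 H2 HG /TBin_inj[_ -> ->] [-> ->]; exists G1, G2.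
Qed.

(* The projections may discard resources, and a name may be split between the
   kept and the discarded component: hence the slack [wk]. *)
Lemma etyping_eval e v : eval e v -> forall G t, etyping G e t ->
  exists2 H, wk H G & etyping H v t.
Proof.
elim=> {e v}.
- by move=> k G t He; exists G => //; exact: wk_refl.
- by move=> a G t He; exists G => //; exact: wk_refl.
- move=> e1 e2 v1 v2 _ IH1 _ IH2 G t He.
  move ee: (EPair e1 e2) He => e He; case: He ee => // {t e}.
  move=> A B {}G f1 f2 t1 t2 HA HB HG [e1E e2E]; subst f1 f2.
  have [A' wA HA'] := IH1 _ _ HA; have [B' wB HB'] := IH2 _ _ HB.
  by have [H H1 H2] := wk_add wA wB HG; exists H => //; exact: TEPair H1.
- move=> e v w ev IH G t He.
  move ee: (EFst e) He => f He; case: He ee => // {t f}.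
  move=> {}G e' t s He us [eE]; subst e'.
  have [H wH /etyping_pair_inv[A [B [HA HB HH]]]] := IH _ _ He.
  have /= /andP[_ vw] := eval_value ev.
  exists A => //; apply: wk_trans wH; exists B => //.
  exact: value_un HB vw us.
- move=> e v w ev IH G t He.
  move ee: (ESnd e) He => f He; case: He ee => // {t f}.
  move=> {}G e' t s He ut [eE]; subst e'.
  have [H wH /etyping_pair_inv[A [B [HA HB HH]]]] := IH _ _ He.
  have /= /andP[vv _] := eval_value ev.
  exists B => //; apply: wk_trans wH; exists A; last exact: envaddC.
  exact: value_un HA vv ut.
- move=> e v _ IH G t He.
  move ee: (EInl e) He => f He; case: He ee => // {t f}.
  move=> {}G e' t s He [eE]; subst e'.
  by have [H wH HH] := IH _ _ He; exists H => //; exact: TEInl.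
- move=> e v _ IH G t He.
  move ee: (EInr e) He => f He; case: He ee => // {t f}.
  move=> {}G e' t s He [eE]; subst e'.
  by have [H wH HH] := IH _ _ He; exists H => //; exact: TEInr.
Qed.

(** How the type of an expression may grow when its environment is weakened. [WTBin] and [WTRefl]
    let one component grow while the other stays fixed. *)
Inductive wkty : ty -> ty -> Prop :=
| WTRefl t : wkty t t
| WTAdd t t0 t' : un t0 -> tadd t t0 t' -> wkty t t'
| WTBin o t t' s s' : wkty t t' -> wkty s s' -> wkty (TBin o t s) (TBin o t' s').

Lemma wkty_un t t' : wkty t t' -> un t -> un t'.
Proof.
elim=> {t t'} // [t t0 t' u0 H ut|o t t' s s' _ IH1 _ IH2].
  exact: tadd_un H.
by case/un_bin=> /IH1 u1 /IH2 u2; apply/un_bin.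
Qed.

Lemma wkty_bin o t s r : wkty (TBin o t s) r ->
  exists t' s', [/\ r = TBin o t' s', wkty t t' & wkty s s'].
Proof.
move eq: (TBin o t s) => q H; case: H eq => {q r}.
- by move=> _ <-; exists t, s; split=> //; exact: WTRefl.
- move=> t1 t0 {}r u0 H e; rewrite -{t1}e in H.
  have [t1 [t2 [s1 [s2 [e0 eR H1 H2]]]]] := tadd_bin H.
  rewrite {}e0 in u0; have [u1 u2] := (un_bin _ _ _).1 u0.
  by exists s1, s2; split=> //; [exact: WTAdd H1 | exact: WTAdd H2].
- by move=> o' t1 t' s1 s' H1 H2 /TBin_inj[-> -> ->]; exists t', s'.
Qed.

Lemma un_chan_inv k1 k2 t : un (TChan k1 k2 t) -> uadd k1 k1 = k1 /\ uadd k2 k2 = k2.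
Proof.
case/tadd_chan=> k3 [k4 [e1 e2]].
case: (TChan_inj e1) e2 => <- <- _ /TChan_inj[e3 e4 _].
by rewrite -e3 -e4.
Qed.

(** An unlimited use equals its double, so the surplus can be written [uadd j j], the form for which
    the output rule leaves room. *)
Lemma wkty_chan k1 k2 t r : wkty (TChan k1 k2 t) r ->
  exists j1 j2, r = TChan (uadd k1 (uadd j1 j1)) (uadd k2 (uadd j2 j2)) t.
Proof.
move eq: (TChan k1 k2 t) => q H; case: H eq => {q r}.
- by move=> _ <-; exists U0, U0; case: k1 k2 => [] [].
- move=> t1 t0 {}r u0 H e; rewrite -{t1}e in H.
  have [j1 [j2 [e0 ->]]] := tadd_chan H; rewrite {}e0 in u0.
  by have [<- <-] := un_chan_inv u0; exists j1, j2; case: j1 j2 {H u0} => [] [].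
- by move=> ? ? ? ? ? _ _ e; have := congr1 (fun r => lab r [::]) e.
Qed.

(** The surplus goes to a single leaf, in a pair always on the right. Under a projection the
    discarded type may grow, but stays unlimited by [wkty_un]. *)
Lemma etyping_wk G e t : etyping G e t -> forall G', wk G G' ->
  exists2 t', wkty t t' & etyping G' e t'.
Proof.
elim=> {G e t}.
- move=> G k uG G' w; exists TInt; first exact: WTRefl.
  by apply: TEInt; exact: wk_un w.
- move=> G u t uG /fnd_None uN G' [X uX HX].
  have uG' : unenv G'.[~ u].
    apply: unenv_add (envadd_rem u HX); last exact: unenv_rem.
    by rewrite set_rem.
  have := HX u; rewrite fnd_set eqxx; case E: X.[? u] => [s|].
    case=> t' tt Gu; exists t'; last exact: etyping_name.
    by apply: WTAdd tt; exact: uX E.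
  by move=> Gu; exists t; [exact: WTRefl | exact: etyping_name].
- move=> G e t s _ IH G' /IH[t' tt He]; exists (TBin Plus t' s).
    by apply: WTBin => //; exact: WTRefl.
  exact: TEInl.
- move=> G e t s _ IH G' /IH[t' tt He]; exists (TBin Plus t t').
    by apply: WTBin => //; exact: WTRefl.
  exact: TEInr.
- move=> A B G e1 e2 t1 t2 HA _ HB IH HG G' w.
  have [B' /IH[t' tt HB'] HG'] := add_wk HG w.
  by exists (TBin Times t1 t'); [apply: WTBin => //; exact: WTRefl | exact: TEPair HG'].
- move=> G e t s _ IH us G' /IH[r /wkty_bin[t' [s' [-> tt ss]]] He].
  by exists t' => //; apply: TEFst He _; exact: wkty_un ss us.
- move=> G e t s _ IH us G' /IH[r /wkty_bin[t' [s' [-> tt ss]]] He].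
  by exists s' => //; apply: TESnd He _; exact: wkty_un tt us.
Qed.

Definition un_at (G : env) (u : name) : Prop := forall t, G.[? u] = Some t -> un t.

Lemma un_at_add A B G u : un_at A u -> un_at B u -> envadd A B G -> un_at G u.
Proof.
move=> uA uB HG t Gu; have := HG u; rewrite Gu.
case EA: A.[? u] => [s|]; case EB: B.[? u] => [r|] //.
- by case=> q Hq [->]; exact: tadd_un (uA _ EA) (uB _ EB) Hq.
- by case=> ->; exact: uA.
- by case=> ->; exact: uB.
Qed.

(** A name that does not occur reaches each leaf only within the part of the environment required to
    be unlimited. *)
Lemma etyping_strengthen G e t u : etyping G e t -> u \notin efn e ->
  un_at G u /\ etyping G.[~ u] e t.
Proof.
elim=> {G e t} /=.
- move=> G k uG _; split; first exact: uG.
  by apply: TEInt; exact: unenv_rem.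
- move=> G w t uG /fnd_None wN; rewrite inE => /negbTE uw.
  split; first by move=> s; rewrite fnd_set uw; exact: uG.
  apply: etyping_name; first by rewrite fnd_rem1 eq_sym uw fnd_set eqxx.
  move=> z s; rewrite !fnd_rem1 fnd_set; case: eqP => // _; case: (z == u) => //=.
  exact: uG.
- by move=> G e t s _ IH /IH[? ?]; split=> //; exact: TEInl.
- by move=> G e t s _ IH /IH[? ?]; split=> //; exact: TEInr.
- move=> A B G e1 e2 t1 t2 _ IH1 _ IH2 HG.
  rewrite inE negb_or => /andP[/IH1[? ?] /IH2[? ?]]; split.
    exact: un_at_add HG.
  by apply: TEPair (envadd_rem _ HG).
- by move=> G e t s _ IH us /IH[? ?]; split=> //; exact: TEFst us.
- by move=> G e t s _ IH us /IH[? ?]; split=> //; exact: TESnd us.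
Qed.

(* G' is obtained from G by giving up x in exchange for the resources of v. *)
Definition env_subst (x : variable) (v : expression) (G G' : env) : Prop :=
  exists2 Gv, (if G.[? Var x] is Some t then etyping Gv v t else Gv = [fmap]) &
              envadd G.[~ Var x] Gv G'.

(** If [x] occurs on both sides, [value_split] divides the resources of [v] along its type; if on
    one side, they all go there. *)
Lemma env_subst_split x v A B G G' : value v -> envadd A B G -> env_subst x v G G' ->
  exists A' B', [/\ env_subst x v A A', env_subst x v B B' & envadd A' B' G'].
Proof.
move=> vv HG [Gv GvP HG']; have HG1 := envadd_rem (Var x) HG.
have [C [D [CP DP HD]]] : exists C D, [/\
    if A.[? Var x] is Some t then etyping C v t else C = [fmap],
    if B.[? Var x] is Some t then etyping D v t else D = [fmap] &
    envadd C D Gv].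
  have := HG (Var x); move: GvP.
  case: (A.[? _]) (B.[? _]) => [t1|] [t2|] /=.
  - case: (G.[? _]) => [t|] H [t' tt] // [tE]; rewrite -{t'}tE in tt.
    by have [C [D [? ? ?]]] := value_split H vv tt; exists C, D.
  - by move=> H GE; rewrite GE in H; exists Gv, [fmap]; split=> //; exact: envadd0.
  - move=> H GE; rewrite GE in H; exists [fmap], Gv; split=> //.
    by apply: envaddC; exact: envadd0.
  - move=> H GE; rewrite GE in H; exists [fmap], [fmap]; rewrite H; split=> //.
    exact: envadd0.
have [A' [B' [HA HB H]]] := envaddACA HG1 HD HG'.
by exists A', B'; split=> //; [exists C | exists D].
Qed.

Lemma env_subst_un x v G G' : value v -> unenv G -> env_subst x v G G' -> unenv G'.
Proof.
move=> vv uG [Gv GvP HG']; apply: unenv_add HG'; first exact: unenv_rem.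
case E: G.[? Var x] GvP => [t|] H; last by rewrite H; exact: unenv0.
by apply: value_un H vv _; exact: uG E.
Qed.

Lemma env_subst_set x v G G' u t : u != Var x -> env_subst x v G G' ->
  G'.[? u] = None -> env_subst x v G.[u <- t] G'.[u <- t].
Proof.
move=> ux [Gv GvP HG'] Gu; exists Gv; first by rewrite fnd_set eq_sym (negbTE ux).
have -> : G.[u <- t].[~ Var x] = G.[~ Var x].[u <- t].
  apply: env_ext => z; rewrite fnd_rem1 !fnd_set fnd_rem1.
  by case: (z =P u) => [->|_] //; rewrite ux.
apply: envadd_setl => //; have := HG' u; rewrite Gu.
by case: (_.[~ _].[? u]) (Gv.[? u]) => [?|] [?|] //= [].
Qed.

(** At a leaf other than [x], the type of [x] is unlimited, hence so are the resources of [v]; they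
    become the slack [wk]. *)
Lemma etyping_subst x v G e t : value v -> etyping G e t ->
  forall G', env_subst x v G G' ->
  exists2 H, wk H G' & etyping H (esubst x v e) t.
Proof.
move=> vv; elim=> {G e t} /=.
- move=> G k uG G' sG; exists G'; first exact: wk_refl.
  by apply: TEInt; exact: env_subst_un sG.
- move=> G u t uG /fnd_None uN G' [Gv]; case: eqP => [uE|/eqP ux]; first subst u.
    rewrite fnd_set eqxx set_rem // => Hv HG'; exists Gv; last by rewrite eweaken0.
    by exists G => //; exact: envaddC.
  rewrite fnd_set eq_sym (negbTE ux) => GvP HG'.
  exists G.[u <- t].[~ Var x].
    exists Gv => //; case E: G.[? Var x] GvP => [s|] H; last by rewrite H; exact: unenv0.
    by apply: value_un H vv _; exact: uG E.
  apply: etyping_name; first by rewrite fnd_rem1 ux fnd_set eqxx.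
  move=> z s; rewrite !fnd_rem1 fnd_set; case: eqP => // _; case: (z == _) => //=.
  exact: uG.
- by move=> G e t s _ IH G' /IH[H w He]; exists H => //; exact: TEInl.
- by move=> G e t s _ IH G' /IH[H w He]; exists H => //; exact: TEInr.
- move=> A B G e1 e2 t1 t2 _ IH1 _ IH2 HG G' /(env_subst_split vv HG).
  case=> [A' [B' [/IH1[HA wA TA] /IH2[HB wB TB] HG']]].
  by have [H H1 H2] := wk_add wA wB HG'; exists H => //; exact: TEPair H1.
- by move=> G e t s _ IH us G' /IH[H w He]; exists H => //; exact: TEFst us.
- by move=> G e t s _ IH us G' /IH[H w He]; exists H => //; exact: TESnd us.
Qed.

(** * Typing of processes *)

(** The opening name [u] may be of either sort, whatever the binder, so that induction hypotheses
    hold at any fresh name. *)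
Inductive ctyping : env -> process -> Prop :=
| CTIdle G : unenv G -> ctyping G PIdle
| CTIn (S : {fset name}) (G1 G2 G : env) e R t k1 k2 :
    etyping G1 e (TChan (uadd U1 k1) (uadd k2 k2) t) ->
    (forall u, u \notin S -> ctyping G2.[u <- t] (popen u R)) ->
    envadd G1 G2 G -> ctyping G (PInB e R)
| CTOut G1 G2 G e f t k1 k2 :
    etyping G1 e (TChan (uadd k1 k1) (uadd U1 k2) t) -> etyping G2 f t ->
    envadd G1 G2 G -> ctyping G (POut e f)
| CTRep G P : ctyping G P -> unenv G -> ctyping G (PRep P)
| CTPar G1 G2 G P1 P2 : ctyping G1 P1 -> ctyping G2 P2 ->
    envadd G1 G2 G -> ctyping G (PPar P1 P2)
| CTNew (S : {fset name}) (G : env) R t k :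
    (forall u, u \notin S -> ctyping G.[u <- TChan k k t] (popen u R)) ->
    ctyping G (PNewB R)
| CTCase (S : {fset name}) (G1 G2 G : env) e R1 R2 t s :
    etyping G1 e (TBin Plus t s) ->
    (forall u, u \notin S -> ctyping G2.[u <- t] (popen u R1)) ->
    (forall u, u \notin S -> ctyping G2.[u <- s] (popen u R2)) ->
    envadd G1 G2 G -> ctyping G (PCaseB e R1 R2).

Definition chooses (S : {fset name}) (G : env) (t : ty) (R : proc 1) : Prop :=
  forall u, u \notin S -> ctyping G.[u <- t] (popen u R).

Lemma ctyping_in_inv G e R : ctyping G (PInB e R) ->
  exists (S : {fset name}) (G1 G2 : env) t k1 k2,
    [/\ etyping G1 e (TChan (uadd U1 k1) (uadd k2 k2) t),
        chooses S G2 t R & envadd G1 G2 G].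
Proof.
move eP: (PInB e R) => P H; case: H eP => //.
by move=> S G1 G2 {}G e' R' t k1 k2 H1 H2 HG [-> ->]; exists S, G1, G2, t, k1, k2.
Qed.

Lemma ctyping_out_inv G e f : ctyping G (POut e f) ->
  exists G1 G2 t k1 k2, [/\ etyping G1 e (TChan (uadd k1 k1) (uadd U1 k2) t),
    etyping G2 f t & envadd G1 G2 G].
Proof.
move eP: (POut e f) => P H; case: H eP => //.
by move=> G1 G2 {}G e' f' t k1 k2 H1 H2 HG [-> ->]; exists G1, G2, t, k1, k2.
Qed.

Lemma ctyping_rep_inv G P : ctyping G (PRep P) -> ctyping G P /\ unenv G.
Proof.
by move eP: (PRep P) => Q H; case: H eP => // {}G {}Q H uG [->].
Qed.

Lemma ctyping_par_inv G P Q : ctyping G (PPar P Q) ->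
  exists G1 G2, [/\ ctyping G1 P, ctyping G2 Q & envadd G1 G2 G].
Proof.
move eP: (PPar P Q) => R H; case: H eP => //.
by move=> G1 G2 {}G P1 P2 H1 H2 HG [-> ->]; exists G1, G2.
Qed.

Lemma ctyping_new_inv G R : ctyping G (PNewB R) ->
  exists (S : {fset name}) t k, chooses S G (TChan k k t) R.
Proof.
move eP: (PNewB R) => P H; case: H eP => //.
by move=> S {}G R' t k H [->]; exists S, t, k.
Qed.

Lemma ctyping_case_inv G e R1 R2 : ctyping G (PCaseB e R1 R2) ->
  exists (S : {fset name}) (G1 G2 : env) t s,
    [/\ etyping G1 e (TBin Plus t s), chooses S G2 t R1, chooses S G2 s R2 &
        envadd G1 G2 G].
Proof.
move eP: (PCaseB e R1 R2) => P H; case: H eP => //.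
by move=> S G1 G2 {}G e' R1' R2' t s H1 H2 H3 HG [-> -> ->]; exists S, G1, G2, t, s.
Qed.

Lemma ctyping_ren f G P : involutive f -> ctyping G P ->
  ctyping (renenv f G) (pren f P).
Proof.
move=> fK; have body (S : {fset name}) (H : env) t (R : proc 1) :
    (forall u, u \notin S -> ctyping (renenv f H.[u <- t]) (pren f (popen u R))) ->
    chooses (f @` S) (renenv f H) t (pren f R).
  move=> IH u uS; have := IH (f u); rewrite ren_set // pren_popen !fK; apply.
  by apply: contra uS => uS; apply/imfsetP; exists (f u); rewrite ?fK.
elim=> {G P} /=.
- by move=> G uG; apply: CTIdle; exact: unenv_ren.
- move=> S G1 G2 G e R t k1 k2 He _ /body HR HG.
  by apply: CTIn HR (envadd_ren fK HG); exact: etyping_ren He.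
- move=> G1 G2 G e g t k1 k2 He Hg HG.
  by apply: CTOut (etyping_ren fK Hg) (envadd_ren fK HG); exact: etyping_ren He.
- by move=> G P _ IH uG; apply: CTRep => //; exact: unenv_ren.
- by move=> G1 G2 G P1 P2 _ H1 _ H2 HG; exact: CTPar (envadd_ren fK HG).
- by move=> S G R t k _ /body HR; exact: CTNew HR.
- move=> S G1 G2 G e R1 R2 t s He _ /body HR1 _ /body HR2 HG.
  by apply: CTCase HR1 HR2 (envadd_ren fK HG); exact: etyping_ren He.
Qed.

Lemma notin_pclose n u (P : proc n) : u \notin fn (pclose u P).
Proof.
have E m (e : expr m) : u \notin efn (eclose u e).
  elim: e => //= [w|e1 IH1 e2 IH2]; last by rewrite inE negb_or IH1.
  by case: eqP => //= /eqP wu; rewrite inE eq_sym.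
elim: P => //= [m e P IH|m e f|m P IHP Q IHQ|m e P IHP Q IHQ];
  by rewrite !inE !negb_or ?E ?IH ?IHP ?IHQ.
Qed.

(** One fresh name is enough: the body opened with any other fresh name is obtained by a
    transposition, and [ctyping] is equivariant. *)
Lemma chooses_some (G : env) u t R : G.[? u] = None -> u \notin fn R ->
  ctyping G.[u <- t] (popen u R) -> exists S, chooses S G t R.
Proof.
move=> Gu uR H; exists (u |` (domf G `|` fn R)) => w.
rewrite !inE !negb_or => /and3P[wu /not_fnd Gw wR].
rewrite -(ren_swap_set t Gu Gw) (@popen_swap _ u w) //.
  by apply: ctyping_ren => //; exact: nswapK.
by apply/negP=> /fn_popen[/eqP|]; apply/negP.
Qed.

Lemma typing_ctyping G P : typing G P -> ctyping G P.
Proof.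
have body (H : env) u t Q : u \notin domf H -> ctyping H.[u <- t] Q ->
    exists S, chooses S H t (pclose u Q).
  move=> /not_fnd Hu HQ; apply: (@chooses_some _ u) => //.
    exact: notin_pclose.
  by rewrite popen_pclose.
elim=> {G P}.
- exact: CTIdle.
- move=> G1 G2 G e x P t k1 k2 He xN _ /(body _ _ _ _ xN)[S HR] HG.
  exact: CTIn He HR HG.
- by move=> G1 G2 G e f t k1 k2 He Hf HG; exact: CTOut He Hf HG.
- by move=> G P _ H uG; exact: CTRep.
- by move=> G1 G2 G P1 P2 _ H1 _ H2 HG; exact: CTPar H1 H2 HG.
- by move=> G a P t k aN _ /(body _ _ _ _ aN)[S HR]; exact: CTNew HR.
- move=> G1 G2 G e x P y Q t s He xN _ /(body _ _ _ _ xN)[S HR].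
  move=> yN _ /(body _ _ _ _ yN)[S' HR'] HG.
  apply: (CTCase (S := S `|` S') He _ _ HG) => u; rewrite inE negb_or => /andP[? ?].
    exact: HR.
  exact: HR'.
Qed.

(** The cofinite premise supplies a name of the sort that the binder requires. *)
Lemma ctyping_typing G P : ctyping G P -> typing G P.
Proof.
have fr (S : {fset name}) (H : env) (R : proc 1) (f : nat -> name) : injective f ->
    exists n, [/\ f n \notin S, f n \notin domf H & pclose (f n) (popen (f n) R) = R].
  move=> fI; have [n] := fresh (S `|` (domf H `|` fn R)) fI.
  by rewrite !inE !negb_or => /and3P[? ? ?]; exists n; rewrite pclose_popen.
elim=> {G P}.
- exact: TPIdle.
- move=> S G1 G2 G e R t k1 k2 He _ IH HG.
  have [x [xS xG <-]] := fr S G2 R _ Var_inj.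
  exact: TPIn He xG (IH _ xS) HG.
- by move=> G1 G2 G e f t k1 k2 He Hf HG; exact: TPOut He Hf HG.
- by move=> G P _ H uG; exact: TPRep.
- by move=> G1 G2 G P1 P2 _ H1 _ H2 HG; exact: TPPar H1 H2 HG.
- move=> S G R t k _ IH; have [a [aS aG <-]] := fr S G R _ Chan_inj.
  exact: TPNew aG (IH _ aS).
- move=> S G1 G2 G e R1 R2 t s He _ IH1 _ IH2 HG.
  have [x [xS xG <-]] := fr S G2 R1 _ Var_inj; have [y [yS yG <-]] := fr S G2 R2 _ Var_inj.
  exact: TPCase He xG (IH1 _ xS) yG (IH2 _ yS) HG.
Qed.

(** * Weakening, strengthening and substitution for processes *)

Lemma ctyping_wk G P : ctyping G P -> forall G', wk G G' -> ctyping G' P.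
Proof.
have body (S : {fset name}) (H H' : env) t (R : proc 1) :
    (forall u, u \notin S -> forall G', wk H.[u <- t] G' -> ctyping G' (popen u R)) ->
    wk H H' -> chooses (S `|` domf H') H' t R.
  move=> IH w u; rewrite inE negb_or => /andP[uS /not_fnd H'u].
  by apply: IH uS _ _; exact: wk_set.
elim=> {G P}.
- by move=> G uG G' w; apply: CTIdle; exact: wk_un w.
- move=> S G1 G2 G e R t k1 k2 He _ IH HG G' w.
  (* The surplus goes to the continuation, which leaves the typing of the subject untouched. *)
  by have [H /(body _ _ _ _ _ IH) HR HG'] := add_wk HG w; exact: CTIn He HR HG'.
- move=> G1 G2 G e f t k1 k2 He Hf HG G' w.
  have [H wH HG'] := add_wk (envaddC HG) w.
  have [_ /wkty_chan[j1 [j2 ->]] He'] := etyping_wk He wH.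
  (* The surplus doubles are absorbed by the rule: [2k1 + 2j1 = 2(k1 + j1)] for input and
     [(1 + k2) + 2j2 = 1 + (k2 + 2j2)] for output. *)
  apply: (@CTOut H G2 G' e f t (uadd k1 j1) (uadd k2 (uadd j2 j2))) => //.
    have -> : uadd (uadd k1 j1) (uadd k1 j1) = uadd (uadd k1 k1) (uadd j1 j1).
      by case: k1 j1 {He He'} => [] [].
    by rewrite (uaddA U1).
  exact: envaddC.
- by move=> G P _ IH uG G' w; apply: CTRep; [exact: IH | exact: wk_un w].
- move=> G1 G2 G P1 P2 H1 _ _ IH HG G' w.
  by have [H /IH H2 HG'] := add_wk HG w; exact: CTPar H1 H2 HG'.
- by move=> S G R t k _ IH G' /(body _ _ _ _ _ IH); exact: CTNew.
- move=> S G1 G2 G e R1 R2 t s He _ IH1 _ IH2 HG G' w.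
  have [H wH HG'] := add_wk HG w.
  exact: CTCase He (body _ _ _ _ _ IH1 wH) (body _ _ _ _ _ IH2 wH) HG'.
Qed.

Lemma ctyping_strengthen G P u : ctyping G P -> u \notin fn P ->
  un_at G u /\ ctyping G.[~ u] P.
Proof.
have body (S : {fset name}) (H : env) t (R : proc 1) :
    (forall w, w \notin S -> u \notin fn (popen w R) ->
       un_at H.[w <- t] u /\ ctyping H.[w <- t].[~ u] (popen w R)) ->
    u \notin fn R -> un_at H u /\ chooses (u |` S) H.[~ u] t R.
  move=> IH uR.
  have {}IH w : w \notin u |` S ->
      un_at H u /\ ctyping H.[~ u].[w <- t] (popen w R).
    rewrite !inE negb_or => /andP[wu wS].
    have [|uH HR] := IH w wS.
      by apply/negP=> /fn_popen[/eqP|]; apply/negP; rewrite // eq_sym.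
    split; first by move=> s; have := uH s; rewrite fnd_set eq_sym (negbTE wu).
    have <- // : H.[w <- t].[~ u] = H.[~ u].[w <- t].
    apply: env_ext => z; rewrite fnd_rem1 !fnd_set fnd_rem1.
    by case: (z =P w) => [->|_]; rewrite ?wu.
  split; last by move=> w /IH[].
  (* That [u] is unlimited in [H] does not depend on the opening name, so any fresh one serves. *)
  have [n /IH[]//] := fresh (u |` S) Var_inj.
elim=> {G P} /=.
- by move=> G uG _; split; [exact: uG | apply: CTIdle; exact: unenv_rem].
- move=> S G1 G2 G e R t k1 k2 He _ IH HG; rewrite inE negb_or => /andP[ue uR].
  have [u2 HR] := body _ _ _ _ IH uR.
  have [u1 He'] := etyping_strengthen He ue.
  split; first exact: un_at_add HG.
  exact: CTIn He' HR (envadd_rem _ HG).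
- move=> G1 G2 G e f t k1 k2 He Hf HG; rewrite inE negb_or => /andP[ue uf].
  have [u1 He'] := etyping_strengthen He ue.
  have [u2 Hf'] := etyping_strengthen Hf uf.
  split; first exact: un_at_add HG.
  exact: CTOut He' Hf' (envadd_rem _ HG).
- by move=> G P _ IH uG /IH[? ?]; split=> //; apply: CTRep => //; exact: unenv_rem.
- move=> G1 G2 G P1 P2 _ IH1 _ IH2 HG; rewrite inE negb_or => /andP[/IH1[? H1] /IH2[? H2]].
  by split; [exact: un_at_add HG | exact: CTPar H1 H2 (envadd_rem _ HG)].
- move=> S G R t k _ IH uR; have [u1 HR] := body _ _ _ _ IH uR.
  by split=> //; exact: CTNew HR.
- move=> S G1 G2 G e R1 R2 t s He _ IH1 _ IH2 HG.
  rewrite !inE !negb_or => /and3P[ue uR1 uR2].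
  have [u1 He'] := etyping_strengthen He ue.
  have [u2 HR1] := body _ _ _ _ IH1 uR1; have [_ HR2] := body _ _ _ _ IH2 uR2.
  split; first exact: un_at_add HG.
  exact: CTCase He' HR1 HR2 (envadd_rem _ HG).
Qed.

(** Expressions lose unlimited resources under substitution; [ctyping_wk] gives them back to the
    whole process. *)
Lemma ctyping_subst x v G P : value v -> ctyping G P ->
  forall G', env_subst x v G G' -> ctyping G' (psubst x v P).
Proof.
move=> vv; have body (S : {fset name}) (H H' : env) t (R : proc 1) :
    (forall u, u \notin S -> forall G', env_subst x v H.[u <- t] G' ->
       ctyping G' (psubst x v (popen u R))) ->
    env_subst x v H H' -> chooses (Var x |` (S `|` domf H')) H' t (psubst x v R).
  move=> IH sH u; rewrite !inE !negb_or => /and3P[ux uS /not_fnd H'u].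
  rewrite -psubst_popen //; apply: IH => //; exact: env_subst_set.
elim=> {G P} /=.
- by move=> G uG G' sG; apply: CTIdle; exact: env_subst_un sG.
- move=> S G1 G2 G e R t k1 k2 He _ IH HG G' /(env_subst_split vv HG).
  case=> [A [B [/(etyping_subst vv He)[A' wA HA] sB HG']]].
  have [K K1 K2] := wk_addl wA HG'.
  by apply: ctyping_wk K2; exact: CTIn HA (body _ _ _ _ _ IH sB) K1.
- move=> G1 G2 G e f t k1 k2 He Hf HG G' /(env_subst_split vv HG).
  case=> [A [B [/(etyping_subst vv He)[A' wA HA] /(etyping_subst vv Hf)[B' wB HB] HG']]].
  have [K K1 K2] := wk_add wA wB HG'.
  by apply: ctyping_wk K2; exact: CTOut HA HB K1.
- by move=> G P _ IH uG G' sG; apply: CTRep; [exact: IH | exact: env_subst_un sG].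
- move=> G1 G2 G P1 P2 _ IH1 _ IH2 HG G' /(env_subst_split vv HG).
  by case=> [A [B [/IH1 HA /IH2 HB HG']]]; exact: CTPar HA HB HG'.
- by move=> S G R t k _ IH G' /(body _ _ _ _ _ IH); exact: CTNew.
- move=> S G1 G2 G e R1 R2 t s He _ IH1 _ IH2 HG G' /(env_subst_split vv HG).
  case=> [A [B [/(etyping_subst vv He)[A' wA HA] sB HG']]].
  have [K K1 K2] := wk_addl wA HG'; apply: ctyping_wk K2.
  exact: CTCase HA (body _ _ _ _ _ IH1 sB) (body _ _ _ _ _ IH2 sB) K1.
Qed.

(** The bound variable is first renamed to a fresh [y], at which the body is typed; [psubst_swap]
    identifies the two substitutions. *)
Lemma chooses_subst S (G1 G2 G : env) t x v Q : chooses S G1 t (pclose (Var x) Q) ->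
  etyping G2 v t -> value v -> envadd G1 G2 G -> ctyping G (psubst x v Q).
Proof.
move=> HQ Hv vv HG.
have [y] := fresh (S `|` (domf G1 `|` fn Q)) Var_inj.
rewrite !inE !negb_or => /and3P[yS /not_fnd Gy yQ].
have := HQ _ yS; rewrite popen_pclose_swap // => /(ctyping_subst vv) H.
rewrite -(psubst_swap x v yQ); apply: H.
by exists G2; rewrite ?fnd_set ?eqxx // set_rem.
Qed.

(** A transposition turns the opened body into [P] itself, where the implication applies, and the
    same transposition leads back. *)
Lemma chooses_map S G t w P P' : (forall G, ctyping G P -> ctyping G P') ->
  chooses S G t (pclose w P) -> chooses (S `|` (fn P `|` fn P')) G t (pclose w P').
Proof.
move=> PP' HP u; rewrite !inE !negb_or => /and3P[uS uP uP'].
have := HP u uS; rewrite !popen_pclose_swap // => /(ctyping_ren (nswapK w u)).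
rewrite prenK; last exact: nswapK.
move/PP'/(ctyping_ren (nswapK w u)); rewrite renK //; exact: nswapK.
Qed.

(** * Structural pre-congruence *)

Lemma popen2_pclose2 n a b c d (P : proc n) :
  a != b -> c != b -> d != a -> d != c -> c \notin fn P -> d \notin fn P ->
  popen d (popen c (pclose a (pclose b P))) = pren (nswap b d \o nswap a c) P.
Proof.
move=> ab cb da dc cP dP; rewrite popen_pclose_swap; last first.
  by apply: contra cP; exact: fn_pclose.
rewrite pren_pclose; last exact: inv_inj (nswapK _ _).
rewrite nswapD ?[b == _]eq_sym // popen_pclose_swap ?pren_comp //.
by rewrite fn_pren ?nswapD //; exact: nswapK.
Qed.

Lemma nswapC a b c d z : a != b -> c != b -> d != a -> d != c -> z != c -> z != d ->
  nswap b d (nswap a c z) = nswap a c (nswap b d z).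
Proof.
move=> ab cb da dc zc zd; have ba : b != a by rewrite eq_sym.
have cd : c != d by rewrite eq_sym.
case: (z =P a) => [-> {z zc zd}|/eqP za].
  by rewrite nswapL !(nswapD (u := b)) ?nswapL // eq_sym.
case: (z =P b) => [->|/eqP zb]; last by rewrite !nswapD.
by rewrite nswapL !(nswapD (u := a)) ?nswapL // eq_sym.
Qed.

(** With fresh [c] for [a] and [d] for [b], both orders of opening give the same process, because
    the two transpositions have disjoint supports. The binders are then rebuilt in the other order
    by [chooses_some]. *)
Lemma ctyping_newC a b P G : ctyping G (PNew a (PNew b P)) ->
  ctyping G (PNew b (PNew a P)).
Proof.
case: (a =P b) => [-> //|/eqP ab].
case/ctyping_new_inv=> [S [t [k H]]].
have abn : Chan a != Chan b by apply: contra ab => /eqP[->].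
have [c'] := fresh (S `|` (domf G `|` (fn P `|` [fset Chan a; Chan b]))) Chan_inj.
move: (Chan c') => c {c'}; rewrite !inE !negb_or -?andbA.
case/and5P=> cS /not_fnd cG cP ca cb.
have := H c cS; rewrite [popen _ _]/=; case/ctyping_new_inv=> [S' [s [k' H']]].
have [d'] := fresh (S' `|` (domf G `|` (fn P `|` [fset Chan a; Chan b; c]))) Chan_inj.
move: (Chan d') => d {d'}; rewrite !inE !negb_or -?andbA.
case/andP=> dS /and5P[/not_fnd dG dP da db dc].
have clos w z : z \notin fn P -> z \notin fn (pclose w P).
  by apply: contra; exact: fn_pclose.
have clos2 w w' z : z \notin fn P -> z \notin fn (pclose w' (pclose w P)).
  by move/(clos w); apply: contra; exact: fn_pclose.
have := H' d dS; rewrite popen2_pclose2 // => HP.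
have [||| S1 HS1] := @chooses_some G.[d <- TChan k' k' s] c (TChan k k t)
    (popen d (pclose (Chan b) (pclose (Chan a) P))).
- by rewrite fnd_set eq_sym (negbTE dc).
- apply/negP=> /fn_popen[/eqP|]; apply/negP; first by rewrite eq_sym.
  exact: clos2.
- have ba : Chan b != Chan a by rewrite eq_sym.
  have cd : c != d by rewrite eq_sym.
  rewrite popen2_pclose2 //.
  have -> : G.[d <- TChan k' k' s].[c <- TChan k k t] =
            G.[c <- TChan k k t].[d <- TChan k' k' s].
    apply: env_ext => z; rewrite !fnd_set; case: (z =P c) => [->|//].
    by rewrite eq_sym (negbTE dc).
  rewrite (@eq_pren _ _ (nswap (Chan b) d \o nswap (Chan a) c)) // => z zP /=.
  rewrite -nswapC //; first by apply: contraNneq cP => <-.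
  by apply: contraNneq dP => <-.
have [||| S2 HS2] := @chooses_some G d (TChan k' k' s)
    (pclose (Chan b) (PNewB (pclose (Chan a) P))).
- by [].
- exact: clos2.
- exact: CTNew HS1.
exact: CTNew HS2.
Qed.

Lemma ctyping_new_par a P Q G : Chan a \notin fn Q ->
  ctyping G (PPar (PNew a P) Q) -> ctyping G (PNew a (PPar P Q)).
Proof.
move=> aQ /ctyping_par_inv[A [B [/ctyping_new_inv[S [t [k HP]]] HQ HG]]].
apply: (@CTNew (S `|` (domf B `|` fn Q)) _ _ t k) => u.
rewrite !inE !negb_or => /and3P[uS /not_fnd uB uQ] /=.
rewrite (@popen_pclose_swap _ _ _ Q) // pren_swap_fresh //.
exact: CTPar (HP _ uS) HQ (envadd_setl _ HG uB).
Qed.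

(** The typing of the parallel composition may give [Q] a share of the restricted channel.
    Strengthening shows this share to be unlimited and removes it; weakening hands it to [P]. *)
Lemma ctyping_par_new a P Q G : Chan a \notin fn Q ->
  ctyping G (PNew a (PPar P Q)) -> ctyping G (PPar (PNew a P) Q).
Proof.
move=> aQ /ctyping_new_inv[S [t [k H]]].
have [c] := fresh (S `|` (domf G `|` (fn P `|` fn Q))) Chan_inj.
move: (Chan c) => u {c}; rewrite !inE !negb_or => /and4P[uS /not_fnd uG uP uQ].
have := H u uS; rewrite /= (@popen_pclose_swap _ _ _ Q) // (@pren_swap_fresh _ _ _ Q) //.
case/ctyping_par_inv=> [A [B [HP HQ HG]]].
have [uB HQ'] := ctyping_strengthen HQ uQ.
have HAB : envadd A.[~ u] B.[~ u] G.
  by have := envadd_rem u HG; rewrite set_rem.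
have wA : wk A A.[~ u].[u <- TChan k k t].
  (* The share of [u] held by [B], to be added to [A]. *)
  pose X : env := if B.[? u] is Some s then env1 u s else [fmap].
  have XE z : X.[? z] = if z == u then B.[? u] else None.
    by rewrite /X /env1; case: B.[? u] => [s|]; rewrite ?fnd_set fnd_fmap0 ?if_same.
  exists X => z; rewrite XE; first by move=> r; case: eqP => // _; exact: uB.
  have := HG z; rewrite !fnd_set fnd_rem1; case: eqP => [->|_] //= _.
  by case: A.[? z].
have [|||S' HP'] := @chooses_some A.[~ u] u (TChan k k t) (pclose (Chan a) P).
- by rewrite fnd_rem1 eqxx.
- by apply: contra uP; exact: fn_pclose.
- exact: ctyping_wk HP _ wA.
by apply: CTPar HAB; first exact: CTNew HP'.
Qed.

Lemma ctyping_parC P Q G : ctyping G (PPar P Q) -> ctyping G (PPar Q P).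
Proof.
by case/ctyping_par_inv=> [A [B [HP HQ HG]]]; apply: CTPar HQ HP _; exact: envaddC.
Qed.

Lemma ctyping_parA P Q R G : ctyping G (PPar P (PPar Q R)) <->
  ctyping G (PPar (PPar P Q) R).
Proof.
split.
  case/ctyping_par_inv=> [A [X [HP /ctyping_par_inv[B [C [HQ HR HX]]] HG]]].
  by have [Y HY HG'] := envaddCA HX HG; exact: CTPar (CTPar HP HQ HY) HR HG'.
case/ctyping_par_inv=> [X [C [/ctyping_par_inv[A [B [HP HQ HX]]] HR HG]]].
by have [Y HY HG'] := envaddA HX HG; exact: CTPar HP (CTPar HQ HR HY) HG'.
Qed.

Lemma struct_ax_typing P Q G : struct_ax P Q -> ctyping G P <-> ctyping G Q.
Proof.
case=> {P Q} [P|P Q|P Q R|a b P|a P Q aQ].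
- split=> [/ctyping_par_inv[A [B [HI HP HG]]]|HP].
    (* The resources of [PIdle] are unlimited, so weakening transfers them to [P]. *)
    have uA : unenv A by move eI: (PIdle) HI => I HI; case: HI eI.
    by apply: ctyping_wk HP _ _; exists A => //; exact: envaddC.
  apply: ctyping_parC; apply: CTPar HP (CTIdle unenv0) _; exact: envadd0.
- by split; exact: ctyping_parC.
- exact: ctyping_parA.
- by split; exact: ctyping_newC.
- by split; [exact: ctyping_new_par | exact: ctyping_par_new].
Qed.

Lemma precong_typing P Q : precong P Q -> forall G, ctyping G P -> ctyping G Q.
Proof.
elim=> {P Q}.
- by move=> P Q /struct_ax_typing PQ G /PQ.
- by move=> P Q /struct_ax_typing PQ G /PQ.
(* An unlimited environment is its own double, so it types the replication and the extra copy. *)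
- move=> P G H; have [HP uG] := ctyping_rep_inv H.
  exact: CTPar H HP (unenv_dup uG).
- by [].
- by move=> P Q R _ PQ _ QR G /PQ/QR.
- move=> e x P P' _ PP' G /ctyping_in_inv[S [A [B [t [k1 [k2 [He HP HG]]]]]]].
  exact: CTIn He (chooses_map PP' HP) HG.
- move=> P P' Q Q' _ PP' _ QQ' G /ctyping_par_inv[A [B [/PP' HP /QQ' HQ HG]]].
  exact: CTPar HP HQ HG.
- by move=> P P' _ PP' G /ctyping_rep_inv[/PP' HP uG]; exact: CTRep.
- move=> a P P' _ PP' G /ctyping_new_inv[S [t [k HP]]].
  exact: CTNew (chooses_map PP' HP).
- move=> e x P P' y Q Q' _ PP' _ QQ' G.
  case/ctyping_case_inv=> [S [A [B [t [s [He HP HQ HG]]]]]].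
  have HP' := chooses_map PP' HP; have HQ' := chooses_map QQ' HQ.
  pose S' := (S `|` (fn P `|` fn P')) `|` (S `|` (fn Q `|` fn Q')).
  by apply: (@CTCase S' _ _ _ _ _ _ _ _ He _ _ HG) => u;
    rewrite /S' in_fsetU negb_or => /andP[uP uQ]; [exact: HP' | exact: HQ'].
Qed.

(** * Reduction *)

Lemma ctyping_comm G e1 e2 f v a x Q :
  eval e1 (EName (Chan a)) -> eval e2 (EName (Chan a)) -> eval f v ->
  ctyping G (PPar (POut e1 f) (PIn e2 x Q)) ->
  exists2 G', ctyping G' (psubst x v Q) & envred (LChan a) G G'.
Proof.
move=> ev1 ev2 evf /ctyping_par_inv[A [B [HA HB HG]]].
have [A1 [A2 [t [k1 [k2 [He1 Hf HA12]]]]]] := ctyping_out_inv HA.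
have [S [B1 [B2 [s [k3 [k4 [He2 HQ HB12]]]]]]] := ctyping_in_inv HB.
have [A1' wA1 /etyping_name_inv[A1a uA1]] := etyping_eval ev1 He1.
have [B1' wB1 /etyping_name_inv[B1a uB1]] := etyping_eval ev2 He2.
have [A2' wA2 Hv] := etyping_eval evf Hf.
have [A' HA' wA] := wk_add wA1 wA2 HA12.
have [B' HB' wB] := wk_addl wB1 HB12.
have [H HH [X uX HX]] := wk_add wA wB HG.
(* [U] holds the resources of the two subjects, [V] those of the message and the continuation. *)
have [U [V [HU HV HUV]]] := envaddACA HA' HB' HH.
have := HU (Chan a); rewrite A1a B1a => -[r].
(* Both subjects evaluate to the same channel, so the payload types of sender and receiver
   coincide. *)
case/tadd_chan=> [j1 [j2 [/TChan_inj[e3 e4 st] rE]]] Ua; subst j1 j2 s.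
pose k := uadd k1 k3; pose k' := uadd k2 k4.
(* What remains of [U] once one input and one output use of the channel are consumed; it is
   unlimited and will be reinserted by weakening. *)
pose U' : env := U.[Chan a <- TChan (uadd k k) (uadd k' k') t].
have uU' : unenv U'.
  have uU := unenv_add uA1 uB1 (envadd_rem (Chan a) HU).
  move=> u q; rewrite fnd_set; case: eqP => [_ [<-]|ua Uu].
    by have := un_chan2 k k' t.
  by apply: (uU u); rewrite fnd_rem1; case: eqP ua.
have HU' : envadd U' (env1 (Chan a) (TChan U1 U1 t)) U.
  move=> u; rewrite /env1 !fnd_set fnd_fmap0; case: eqP => [->|_].
    rewrite Ua rE; eexists; last by [].
    have -> : uadd (uadd k1 k1) (uadd U1 k3) = uadd (uadd k k) U1.
      by rewrite /k; case: (k1) (k3) => [] [].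
    have -> : uadd (uadd U1 k2) (uadd k4 k4) = uadd (uadd k' k') U1.
      by rewrite /k'; case: (k2) (k4) => [] [].
    exact: TAChan.
  by case: U.[? u].
have [Y HY HYH] := envaddAC HU' HUV.
have [Z HZ HZG] := envaddAC HYH HX.
exists Z; last exact: ERChan HZG.
have HVQ := chooses_subst HQ Hv (eval_value evf) (envaddC HV).
apply: ctyping_wk HVQ _ _; apply: wk_trans (_ : wk Y Z); last by exists X.
by exists U' => //; exact: envaddC.
Qed.

Lemma envred_ren f a t G G' : involutive f ->
  envadd G' (env1 (Chan a) (TChan U1 U1 t)) (renenv f G) ->
  envadd (renenv f G') (env1 (f (Chan a)) (TChan U1 U1 t)) G.
Proof.
move=> fK /(envadd_ren fK); rewrite renK // /env1 ren_set //.
suff -> : renenv f [fmap] = [fmap] by [].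
by apply: env_ext => z; rewrite fnd_ren // !fnd_fmap0.
Qed.

(** After a communication on a restricted channel the remaining uses may be unbalanced, yet [PNew]
    needs equal ones. If [k] was 1 both are 0; otherwise weakening raises both to omega. *)
Lemma wk_consume (H G : env) u k t s : G.[? u] = None ->
  envadd H (env1 u (TChan U1 U1 s)) G.[u <- TChan k k t] ->
  exists k' t', wk H G.[u <- TChan k' k' t'].
Proof.
move=> Gu HG; pose k' := if k is U1 then U0 else Uomega.
exists k', s; exists (env1 u (TChan k' k' s)).
  move=> z r; rewrite /env1 fnd_set fnd_fmap0; case: eqP => // _ [<-].
  have -> : k' = uadd k' k' by rewrite /k'; case: (k).
  exact: un_chan2.
move=> z; have := HG z; rewrite /env1 !fnd_set fnd_fmap0; case: eqP => [->|_] //.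
case: H.[? u] => [r [q /taddC/tadd_chan[k3 [k4 [-> ->]]] /Some_inj/TChan_inj[e3 e4 _]]|].
  exists (TChan k' k' s) => //.
  suff {2}-> : TChan k' k' s = TChan (uadd k3 k') (uadd k4 k') s by exact: TAChan.
  by rewrite /k'; move: e3 e4; case: (k) (k3) (k4) => [] [] [].
by case/Some_inj/TChan_inj=> -> _ _.
Qed.

Lemma envred_chan_inv a G G' : envred (LChan a) G G' ->
  exists t, envadd G' (env1 (Chan a) (TChan U1 U1 t)) G.
Proof.
by move el: (LChan a) => l H; case: H el => // b t {}G {}G' H [->]; exists t.
Qed.

Lemma envred_tau_inv G G' : envred LTau G G' -> G' = G.
Proof. by move el: LTau => l H; case: H el. Qed.

Lemma envred_par l A A' B G : envred l A A' -> envadd A B G ->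
  exists2 G', envadd A' B G' & envred l G G'.
Proof.
case: l => [a /envred_chan_inv[t H] HG|/envred_tau_inv-> HG].
  have [G' HG' H'] := envaddAC H HG.
  by exists G' => //; exact: ERChan H'.
by exists G => //; exact: ERTau.
Qed.

Lemma chooses_ren (G : env) u w t Q : G.[? u] = None -> u \notin fn Q ->
  ctyping G.[u <- t] (pren (nswap w u) Q) -> exists S, chooses S G t (pclose w Q).
Proof.
move=> Gu uQ H; apply: (@chooses_some _ u) => //.
  by apply: contra uQ; exact: fn_pclose.
by rewrite popen_pclose_swap.
Qed.

Lemma ctyping_red l P Q : red l P Q -> forall G, ctyping G P ->
  exists2 G', ctyping G' Q & envred l G G'.
Proof.
have swK a u : involutive (nswap (Chan a) u) := nswapK _ _.
elim=> {l P Q}.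
- by move=> e1 e2 f a v x Q ev1 ev2 evf G; exact: ctyping_comm.
- move=> e v x P y Q ev G /ctyping_case_inv[S [A [B [t [s [He HP HQ HG]]]]]].
  have [A' wA Hv] := etyping_eval ev He. have vv : value v := eval_value ev.
  have [H HH wH] := wk_addl wA HG.
  exists G; last exact: ERTau; apply: ctyping_wk wH.
  apply: chooses_subst HP _ vv (envaddC HH).
  move: Hv; move eT: (TBin _ _ _) => T; move ei: (EInl v) => w Hw.
  by case: Hw eT ei => // {}G0 e' t' s' He' /TBin_inj[_ -> _] [->].
- move=> e v x P y Q ev G /ctyping_case_inv[S [A [B [t [s [He HP HQ HG]]]]]].
  have [A' wA Hv] := etyping_eval ev He. have vv : value v := eval_value ev.
  have [H HH wH] := wk_addl wA HG.
  exists G; last exact: ERTau; apply: ctyping_wk wH.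
  apply: chooses_subst HQ _ vv (envaddC HH).
  move: Hv; move eT: (TBin _ _ _) => T; move ei: (EInr v) => w Hw.
  by case: Hw eT ei => // {}G0 e' t' s' He' /TBin_inj[_ _ ->] [->].
- move=> l P P' Q _ IH G /ctyping_par_inv[A [B [/IH[A' HP' rA] HQ HG]]].
  have [G' HG' rG] := envred_par rA HG.
  by exists G' => //; exact: CTPar HP' HQ HG'.
(* The fresh [u] stands for the restricted channel, and a swap brings the body back to [P]. The uses
   consumed belong to [u], so [G] itself is unchanged, as [LTau] requires. *)
- move=> a P Q _ IH G /ctyping_new_inv[S [t [k H]]].
  have [c] := fresh (S `|` (domf G `|` (fn P `|` fn Q))) Chan_inj.
  move: (Chan c) => u {c}; rewrite !inE !negb_or => /and4P[uS /not_fnd uG uP uQ].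
  have := H u uS; rewrite popen_pclose_swap // => /(ctyping_ren (swK a u)).
  rewrite prenK // => /IH[G' /(ctyping_ren (swK a u)) HQ].
  case/envred_chan_inv=> s /(envred_ren (swK a u)); rewrite nswapL.
  move/(wk_consume uG)=> [k' [t' w]].
  have [S' HQ'] := chooses_ren uG uQ (ctyping_wk HQ w).
  by exists G; [exact: CTNew HQ' | exact: ERTau].
- move=> l a P Q _ IH la G /ctyping_new_inv[S [t [k H]]].
  (* The fresh name must also avoid the channel of the label, so that the swap fixes that
     channel. *)
  pose L := if l is LChan b then [fset Chan b] else fset0.
  have [c] := fresh (S `|` (domf G `|` (fn P `|` (fn Q `|` L)))) Chan_inj.
  move: (Chan c) => u {c}; rewrite !in_fsetU !negb_or.
  case/and5P=> uS /not_fnd uG uP uQ uL.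
  have := H u uS; rewrite popen_pclose_swap // => /(ctyping_ren (swK a u)).
  rewrite prenK // => /IH[G' /(ctyping_ren (swK a u)) HQ].
  case: l la @L uL {IH} => [b|] la L uL.
    case/envred_chan_inv=> s /(envred_ren (swK a u)).
    have ub : u != Chan b by move: uL; rewrite inE.
    rewrite nswapD 1?eq_sym //; last by apply/eqP=> -[ba]; case: la; rewrite ba.
    have E1 : (env1 (Chan b) (TChan U1 U1 s)).[? u] = None.
      by rewrite /env1 fnd_set fnd_fmap0 (negbTE ub).
    (* The label differs from [u], so the type of [u] survives the reduction and the restriction can
       be rebuilt with it. *)
    move=> HG; have Ku := HG u; rewrite E1 fnd_set eqxx in Ku.
    move/oadd0/esym: Ku => Ku.
    rewrite (rem_set Ku) in HQ.
    have Ru : (renenv (nswap (Chan a) u) G').[~ u].[? u] = None by rewrite fnd_rem1 eqxx.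
    have [S' HQ'] := chooses_ren Ru uQ HQ.
    eexists; first exact: CTNew HQ'.
    by have := envadd_rem u HG; rewrite set_rem // (rem_None E1); exact: ERChan.
  move/envred_tau_inv=> GE; rewrite GE renK // in HQ.
  have [S' HQ'] := chooses_ren uG uQ HQ.
  by exists G; [exact: CTNew HQ' | exact: ERTau].
- move=> l P P' Q Q' PP' _ IH QQ' G /(precong_typing PP')/IH[G' HQ rG].
  by exists G' => //; exact: precong_typing QQ' _ HQ.
Qed.

Theorem theorem3p8 (G : env) (P Q : process) (l : label) :
  typing G P -> red l P Q -> exists G' : env, typing G' Q /\ envred l G G'.
Proof.
move=> /typing_ctyping HP /ctyping_red/(_ _ HP)[G' HQ rG].
by exists G'; split=> //; exact: ctyping_typing.
Qed.
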